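(* Let $N\ge 2$, $0<s<1$ and $1<p\le\frac{N}{N-2s}$. Assume that $u\in C^{2}(\mathbb{R}^{N})\cap\mathcal{L}_{s}$ is a nonnegative (classical, pointwise) solution of $$-\mathcal{I}u\ge u^{p}\quad\text{in }\mathbb{R}^{N}.$$ Then $u\equiv0$.
   Context: Let $e_1,\dots,e_N$ be the standard orthonormal basis of $\mathbb{R}^N$. The operator is $\mathcal{I}u=\sum_{i=1}^{N}\mathcal{I}_iu$, where $$\mathcal{I}_{i}u(x)=\frac{C_{s}}{2}\int_{\mathbb{R}}\frac{u(x+te_{i})+u(x-te_{i})-2u(x)}{|t|^{1+2s}}\,dt,\qquad C_{s}=\left(\int_{\mathbb{R}}\frac{1-\cos x}{|x|^{1+2s}}\,dx\right)^{-1}.$$ The space $\mathcal{L}_s$ is $$\mathcal{L}_{s}=\left\{u\in L^{1}_{loc}(\mathbb{R}^{N}):\limsup_{|x|\to+\infty}\frac{|u(x)|}{|x|^{2s-\delta_{1}}}<+\infty\text{ for some }\delta_{1}\in(0,2s]\right\}.$$ *)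

(* Defs.v *)
From HB Require Import structures.
From mathcomp Require Import all_boot all_order all_algebra.
From mathcomp Require Import all_classical all_reals all_analysis.

Set Implicit Arguments.
Unset Strict Implicit.
Unset Printing Implicit Defensive.

Import Order.TTheory GRing.Theory Num.Theory.
Import numFieldNormedType.Exports.

Local Open Scope classical_set_scope.
Local Open Scope ring_scope.

Section euclidean_space.
Context {R : realType} {N : nat}.
Implicit Types (x : 'rV[R]_N) (u : 'rV[R]_N -> R).

(* The library norm on ['rV[R]_N] is the sup norm. *)
Definition enorm x : R := Num.sqrt (\sum_(i < N) x ord0 i ^+ 2).

Definition ebase (i : 'I_N) : 'rV[R]_N := delta_mx ord0 i.

Fixpoint Ck (k : nat) u : Prop :=
  continuous u /\
  if k is k'.+1 then
    forall i, (forall x, derivable u x (ebase i)) /\ Ck k' ('D_(ebase i) u)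
  else True.

End euclidean_space.

(* Lebesgue measure on R^n, as the n-fold product of the one-dimensional one.
   It lives on [n.-tuple R], for which the library provides the product
   sigma-algebra, here the Borel one. *)
Section ndim_lebesgue.
Context {R : realType}.
Local Notation RT := (measurableTypeR R).
Local Open Scope ereal_scope.

Section step.
Context {n : nat}.
Variable mu : {sigma_finite_measure set (n.-tuple RT) -> \bar R}.

Definition tuple_of_pair (z : RT * n.-tuple RT) : n.+1.-tuple RT :=
  [tuple of z.1 :: z.2].

Lemma measurable_tuple_of_pair : measurable_fun [set: _] tuple_of_pair.
Proof. exact: measurable_cons. Qed.

Definition lebesgue_step : set (n.+1.-tuple RT) -> \bar R :=
  pushforward (lebesgue_measure \x mu) tuple_of_pair.

Let m : {measure set (n.+1.-tuple RT) -> \bar R} :=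
  measure_function_pushforward__canonical__measure_function_Measure
    (lebesgue_measure \x mu) measurable_tuple_of_pair.

HB.instance Definition _ := isMeasure.Build _ _ _ lebesgue_step
  (measure0 m) (measure_ge0 m) (@measure_semi_sigma_additive _ _ _ m).

Let lebesgue_step_sigma_finite : sigma_finite [set: _] lebesgue_step.
Proof.
have /sigma_finiteP[F [TF ndF Foo]] :=
  sigma_finiteT (lebesgue_measure : {sigma_finite_measure set RT -> \bar R}).
have /sigma_finiteP[G [TG ndG Goo]] := sigma_finiteT mu.
pose H k : set (n.+1.-tuple RT) :=
  [set t | F k (thead t) /\ G k [tuple of behead t]].
exists H.
  apply/esym; rewrite -subTset => t _.
  have [i _ Fi] : (\bigcup_i F i) (thead t) by rewrite -TF.
  have [j _ Gj] : (\bigcup_i G i) [tuple of behead t] by rewrite -TG.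
  exists (maxn i j) => //; split.
    by move: Fi; exact/subsetPset/ndF/leq_maxl.
  by move: Gj; exact/subsetPset/ndG/leq_maxr.
move=> k; have [mF Fk] := Foo k; have [mG Gk] := Goo k; split.
  apply: measurableI; rewrite -[X in measurable X]setTI.
    exact: (@measurable_tnth _ RT n.+1 ord0).
  exact: (@measurable_behead _ RT n).
have preimH : tuple_of_pair @^-1` H k = F k `*` G k.
  apply/seteqP; split => -[a t] [/= Fa Gt]; split => //=.
    by move: Gt; congr (G k); exact/val_inj.
  by move: Gt; congr (G k); exact/val_inj.
rewrite /lebesgue_step /pushforward preimH product_measure1E//.
by rewrite lte_mul_pinfty// ge0_fin_numE.
Qed.

HB.instance Definition _ :=
  Measure_isSigmaFinite.Build _ _ _ lebesgue_step lebesgue_step_sigma_finite.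

End step.

Fixpoint lebesgueN n : {sigma_finite_measure set (n.-tuple RT) -> \bar R} :=
  if n is m.+1 then lebesgue_step (lebesgueN m)
  else (\d_([tuple] : 0.-tuple RT) : {measure set _ -> \bar R}).

End ndim_lebesgue.
Arguments lebesgueN R n : clear implicits.

Section function_spaces.
Context {R : realType} {N : nat}.
Implicit Types (u : 'rV[R]_N -> R).
Local Open Scope ereal_scope.

Definition row_of_tuple (t : N.-tuple (measurableTypeR R)) : 'rV[R]_N :=
  (\row_i tnth t i)%R.

(* The N-dimensional counterpart of the library's [locally_integrable setT]. *)
Definition L1loc u : Prop :=
  measurable_fun [set: _] (u \o row_of_tuple) /\
  forall K : set 'rV[R]_N, compact K ->
    \int[lebesgueN R N]_(t in row_of_tuple @^-1` K)
      `|u (row_of_tuple t)|%:E < +oo.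

Definition near_infinity : set_system 'rV[R]_N :=
  filter_from [set: R] (fun M => [set x | (M < enorm x)%R]).

Definition Ls (s : R) u : Prop :=
  L1loc u /\
  exists2 delta : R, (0 < delta <= 2 * s)%R &
    limf_esup (fun x => (`|u x| / enorm x `^ (2 * s - delta))%:E)
      near_infinity < +oo.

End function_spaces.

Section operator.
Context {R : realType}.

Definition Cs (s : R) : R :=
  (\int[lebesgue_measure]_(x in [set: R])
     ((1 - cos x) / `|x| `^ (1 + 2 * s)))^-1.

Definition Ii (s : R) {N : nat} (i : 'I_N) (u : 'rV[R]_N -> R) (x : 'rV[R]_N)
    : R :=
  Cs s / 2 * \int[lebesgue_measure]_(t in [set: R])
    ((u (x + t *: ebase i) + u (x - t *: ebase i) - 2 * u x)
       / `|t| `^ (1 + 2 * s)).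

Definition Iop (s : R) {N : nat} (u : 'rV[R]_N -> R) (x : 'rV[R]_N) : R :=
  \sum_(i < N) Ii s i u x.

End operator.

(* Main.v *)
Require Import Defs.
From HB Require Import structures.
From mathcomp Require Import all_boot all_order all_algebra.
From mathcomp Require Import all_classical all_reals all_analysis.
From mathcomp Require Import measurable_realfun ring lra.

(** The inequality is tested against the compactly supported weight
    Phi_r(x) = prod_i psi_r(x_i), with psi_r(y) = max(1 - (y/r)^2, 0).

    On the line, the fractional Laplacian L = (-Delta)^s satisfies
    L psi_r <= K r^(-2s) psi_r everywhere. Where psi_r is comparable to 1 this
    is a matter of scaling. Near the ends of the support, where psi_r is
    small, it is due to nonlocality: the jumps into the bulk of the bump
    contribute a fixed negative amount, while semiconvexity of psi_r makes the
    contribution of jumps shorter than theta r as small as desired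
    ([bump_second_difference], [line_inequality]). So a compactly supported
    function can be used although the operator is nonlocal. Because Phi_r is
    a product and the operator is a sum over the coordinate axes, integrating
    the one-dimensional estimate over the other variables
    ([lebesgueN_slice_le], [space_inequality]) gives
      int Phi_r u^p <= kappa r^(-2s) int Phi_r u,
    which is [energy_inequality]. The integration by parts is carried out on
    the positive and the negative part of the second differences of u, so that
    only Tonelli's theorem is involved; the C^2 bound near the diagonal and
    the growth condition at infinity make both parts finite, uniformly on
    cubes ([axis_integral_bounded]), which allows cancellation.

    Young's inequality absorbs the right-hand side up to a constant times
    r^(N - 2sp'), where p' = p/(p-1). The hypothesis p <= N/(N-2s) says exactly
    that this exponent is nonpositive, so int u^p is finite. In the critical
    case the exponent vanishes and a second pass is needed: on a fixed cube
    the factor r^(-2s) tends to 0, and outside it Young's inequality with a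
    large parameter lam leaves a small constant plus lam times the tail of the
    convergent integral int u^p ([split_estimate], [integral_powR_eq0]).
    Hence int u^p = 0, and u = 0 by continuity. *)

Set Implicit Arguments.
Unset Strict Implicit.
Unset Printing Implicit Defensive.

Import Order.TTheory GRing.Theory Num.Theory.
Import numFieldNormedType.Exports.

Local Open Scope classical_set_scope.
Local Open Scope ring_scope.

(** * Integrals of nonnegative functions *)

Lemma integral_bigcup_le (R : realType) (d : measure_display)
    (T : measurableType d) (mu : {measure set T -> \bar R})
    (F : (set T)^nat) (f : T -> \bar R) (C : \bar R) :
  nondecreasing_seq F -> (forall n, measurable (F n)) ->
  measurable_fun [set: T] f -> (forall x, 0 <= f x)%E ->
  (forall n, \int[mu]_(x in F n) f x <= C)%E ->
  (\int[mu]_(x in \bigcup_n F n) f x <= C)%E.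
Proof.
move=> ndF mF mf f0 fC.
have cv := @ge0_nondecreasing_set_cvg_integral _ _ _ _ _ mu ndF mF
  (fun i => measurable_funTS mf) (fun i x _ => f0 x).
rewrite -(cvg_lim _ cv)//; apply: lime_le; first by apply/cvg_ex; eexists; exact: cv.
exact: nearW.
Qed.

Section real_valued_integrals.
Context {R : realType} {d : measure_display} {T : measurableType d}.
Variable mu : {measure set T -> \bar R}.
Implicit Types g h : T -> R.
Local Open Scope ereal_scope.

Lemma ge0_integral_addr g h :
  measurable_fun [set: T] g -> measurable_fun [set: T] h ->
  (forall x, 0 <= g x)%R -> (forall x, 0 <= h x)%R ->
  \int[mu]_x (g x + h x)%R%:E = \int[mu]_x (g x)%:E + \int[mu]_x (h x)%:E.
Proof.
move=> mg mh g0 h0; under eq_integral do rewrite EFinD.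
rewrite ge0_integralD//; first [exact/measurable_EFinP|by move=> *; rewrite lee_fin].
Qed.

Lemma ge0_integral_mulr (c : R) g :
  measurable_fun [set: T] g -> (forall x, 0 <= g x)%R -> (0 <= c)%R ->
  \int[mu]_x (c * g x)%R%:E = c%:E * \int[mu]_x (g x)%:E.
Proof.
move=> mg g0 c0; under eq_integral do rewrite EFinM.
rewrite ge0_integralZl//; first [exact/measurable_EFinP|by move=> *; rewrite lee_fin].
Qed.

Lemma ge0_le_integralr g h :
  measurable_fun [set: T] g -> measurable_fun [set: T] h ->
  (forall x, 0 <= g x)%R -> (forall x, g x <= h x)%R ->
  \int[mu]_x (g x)%:E <= \int[mu]_x (h x)%:E.
Proof.
move=> mg mh g0 gh; apply: ge0_le_integral => //.
- by move=> *; rewrite lee_fin.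
- exact/measurable_EFinP.
- exact/measurable_EFinP.
- by move=> *; rewrite lee_fin.
Qed.

Lemma ge0_integral_sumr (I : finType) (g : I -> T -> R) :
  (forall i, measurable_fun [set: T] (g i)) -> (forall i x, 0 <= g i x)%R ->
  \int[mu]_x (\sum_i g i x)%R%:E = \sum_i \int[mu]_x (g i x)%:E.
Proof.
move=> mg g0; under eq_integral do rewrite -sumEFin.
rewrite ge0_integral_sum//.
- by move=> i; exact/measurable_EFinP.
- by move=> i x _; rewrite lee_fin.
Qed.

End real_valued_integrals.

(** * Lebesgue measure on the line *)

Section line_integrals.
Context {R : realType}.
Local Notation mu := (@lebesgue_measure R).
Local Open Scope ereal_scope.

Lemma lebesgue_measureD (a : R) (A : set R) : measurable A ->
  pushforward mu ((fun y : R => y + a)%R : _ -> measurableTypeR R) A = mu A.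
Proof.
have ma : measurable_fun [set: R]
    ((fun y : R => y + a)%R : R -> measurableTypeR R).
  exact: measurable_funD.
pose m := measure_function_pushforward__canonical__measure_function_Measure mu ma.
move=> mA; apply/esym; rewrite -[RHS]/(m A).
apply: lebesgue_measure_unique => //= _ [[b c]] _ <-.
rewrite /pushforward.
rewrite (_ : _ @^-1` _ = `](b - a)%R, (c - a)%R]%classic); last first.
  by apply/seteqP; split=> y /=; rewrite !in_itv/= ltrBlDr lerBrDr.
rewrite !lebesgue_measure_itv/= !lte_fin ltrD2r; case: ifP => // _.
by rewrite -!EFinB; congr EFin; ring.
Qed.

Lemma ge0_integral_translate (a : R) (f : R -> \bar R) :
  measurable_fun [set: R] f -> (forall y, 0 <= f y) ->
  \int[mu]_y f (y + a)%R = \int[mu]_y f y.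
Proof.
move=> mf f0.
have ma : measurable_fun [set: R]
    ((fun y : R => y + a)%R : R -> measurableTypeR R).
  exact: measurable_funD.
rewrite -[X in integral _ X _](preimage_setT
  ((fun y : R => y + a)%R : measurableTypeR R -> measurableTypeR R)).
rewrite -(@ge0_integral_pushforward _ _ _ (measurableTypeR R) _ _ _ _ setT f)//=.
by apply: eq_measure_integral => //= A mA _; exact/lebesgue_measureD.
Qed.

(** Reduces the integrals against the even kernel to powers on a half-line. *)
Lemma ge0_integral_norm (g : R -> \bar R) :
  measurable_fun [set: R] g -> (forall y, 0 <= g y) ->
  \int[mu]_y g `|y|%R = 2%:E * \int[mu]_(y in `]0%R, +oo[) g y.
Proof.
move=> mg g0.
have mgn : measurable_fun [set: R] (fun y : R => g `|y|%R).
  by apply: measurableT_comp => //; exact: normr_measurable.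
rewrite -[X in integral _ X](setUv `]0%R, +oo[%classic).
rewrite ge0_integral_setU//=; last 3 first.
- exact: measurableC.
- by apply: measurable_funTS.
- exact/disj_setPCl.
rewrite mule_natl mule2n; congr (_ + _).
  by apply: eq_integral => y; rewrite inE/= in_itv/= andbT => y0; rewrite gtr0_norm.
rewrite setCitvr.
under eq_integral do rewrite -normrN.
rewrite -(@ge0_integration_by_substitution0 _ (fun y => g `|y|%R))//.
rewrite -integral_itv_obnd_cbnd; last exact: measurable_funTS.
by apply: eq_integral => y; rewrite inE/= in_itv/= andbT => y0; rewrite gtr0_norm.
Qed.

Lemma integral_powR_itv (c a b : R) : (c != 0)%R -> (0 < a < b)%R ->
  \int[mu]_(t in `[a, b]) (t `^ (c - 1))%:E = ((b `^ c - a `^ c) / c)%:E.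
Proof.
move=> c0 /andP[a0 ab].
have pos t : t \in `[a, b] -> (0 < t)%R.
  by rewrite in_itv/= => /andP[/(lt_le_trans a0)].
have dF (t : R) : (0 < t)%R ->
    is_derive t 1%R (fun t => t `^ c / c)%R (t `^ (c - 1))%R.
  move=> t0.
  rewrite (_ : (fun _ => _) = c^-1%R \*: ((fun t => t `^ c)%R : R -> R)); last first.
    by apply/funext => z; rewrite /= /GRing.scale/= mulrC.
  have := is_deriveZ c^-1%R (is_derive1_powR c t0).
  by rewrite /GRing.scale/= mulrA mulVf// mul1r.
have cF (t : R) : (0 < t)%R -> {for t, continuous (fun t => t `^ c / c)%R}.
  move=> t0; apply: differentiable_continuous; apply/derivable1_diffP.
  by case: (dF t t0).
rewrite (@continuous_FTC2 _ _ (fun t => t `^ c / c)%R)//.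
- by rewrite -EFinB mulrBl.
- apply: derivable_within_continuous => t /pos t0.
  by have [] := is_derive1_powR (c - 1) t0.
- split=> /=.
  + move=> t; rewrite in_itv/= => /andP[at_ _]; have t0 := lt_trans a0 at_.
    by case: (dF t t0).
  + apply: cvg_at_right_filter; exact: cF.
  + by apply: cvg_at_left_filter; apply: cF; exact: lt_trans ab.
- move=> t; rewrite in_itv/= => /andP[at_ _]; have t0 := lt_trans a0 at_.
  by rewrite derive1E; case: (dF t t0) => _ ->.
Qed.

Let powR0_measurable (c : R) : measurable_fun [set: R] (fun t : R => (t `^ c)%:E).
Proof. by apply/measurable_EFinP; exact: measurable_powR. Qed.

Lemma integral_powR_near0 (c r : R) : (0 < c)%R -> (0 < r)%R ->
  \int[mu]_(t in `]0%R, r]) (t `^ (c - 1))%:E <= (r `^ c / c)%:E.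
Proof.
move=> c0 r0.
rewrite (_ : `]0%R, r]%classic = \bigcup_n `[(r / n.+2%:R)%R, r]%classic); last first.
  apply/seteqP; split=> [t|t [n _]]; rewrite /= !in_itv/= => /andP[t0 tr].
    have [n rn] := ltr_add_invr (divr_gt0 t0 r0); exists n => //=.
    rewrite add0r ltr_pdivlMr// in rn.
    rewrite in_itv/= tr andbT; apply: le_trans (ltW rn).
    by rewrite mulrC ler_pM2r// lef_pV2 ?posrE// ler_nat.
  by rewrite tr andbT (lt_le_trans _ t0)// divr_gt0.
apply: integral_bigcup_le => //.
- apply/nondecreasing_seqP => n; rewrite subsetEset => t /=.
  rewrite !in_itv/= => /andP[h ->]; rewrite andbT (le_trans _ h)//.
  by rewrite ler_pM2l// lef_pV2 ?posrE// ler_nat.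
- exact: powR0_measurable.
- by move=> y; rewrite lee_fin powR_ge0.
- move=> n; rewrite integral_powR_itv ?gt_eqF//; last first.
    by rewrite divr_gt0//= ltr_pdivrMr// ltr_pMr// ltr1n.
  rewrite lee_fin ler_pM2r ?invr_gt0// gerBl; exact: powR_ge0.
Qed.

Lemma integral_powR_near_pinfty (c r : R) : (0 < c)%R -> (0 < r)%R ->
  \int[mu]_(t in `[r, +oo[) (t `^ (- c - 1))%:E <= (r `^ (- c) / c)%:E.
Proof.
move=> c0 r0.
rewrite (_ : `[r, +oo[%classic = \bigcup_n `[r, (r + n.+1%:R)%R]%classic); last first.
  apply/seteqP; split=> [t|t [n _]]; rewrite /= !in_itv/= ?andbT.
    move=> rt; exists (Num.truncn t) => //=; rewrite in_itv/= rt /=.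
    rewrite (le_trans (ltW (truncnS_gt t)))// ler_wpDl// ltW//.
  by case/andP.
apply: integral_bigcup_le => //.
- apply/nondecreasing_seqP => n; rewrite subsetEset => t /=.
  rewrite !in_itv/= => /andP[-> h]/=; rewrite (le_trans h)//.
  by rewrite lerD2l ler_nat.
- exact: powR0_measurable.
- by move=> y; rewrite lee_fin powR_ge0.
- move=> n; rewrite integral_powR_itv ?oppr_eq0 ?gt_eqF//; last first.
    by rewrite r0/= ltrDl.
  rewrite lee_fin invrN mulrN -mulNr opprB ler_pM2r ?invr_gt0// gerBl.
  exact: powR_ge0.
Qed.

End line_integrals.

(** * The truncated paraboloid *)

Section bump.
Context {R : realType}.

(** The positive part of a concave parabola: semiconvexity is the only
    regularity that the upper bound on its fractional Laplacian uses, so the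
    corners at [r] and [-r], which are convex, do no harm. *)
Definition bump (r y : R) : R := Num.max (1 - (y / r) ^+ 2) 0.

Lemma bump_ge0 r y : 0 <= bump r y.
Proof. by rewrite le_max lexx orbT. Qed.

Lemma bump_le1 r y : bump r y <= 1.
Proof. by rewrite ge_max ler01 andbT gerBl sqr_ge0. Qed.

Lemma bump0 r y : 0 < r -> r <= `|y| -> bump r y = 0.
Proof.
move=> r0 ry; apply/max_idPr; rewrite subr_le0 -(real_normK (num_real _)) normrM normfV.
by rewrite (gtr0_norm r0) exprn_ege1// ler_pdivlMr// mul1r.
Qed.

Lemma measurable_bump r : measurable_fun [set: R] (bump r).
Proof.
apply: measurable_maxr => //; apply: measurable_funB => //.
by apply: measurable_funX; exact: mulrr_measurable.
Qed.

(** Away from the truncation the second difference of the parabola is exactly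
    [2 * (t / r) ^+ 2], and truncating from below only increases [bump] at
    [y + t] and [y - t]. *)
Lemma bump_semiconvex r y t : 0 < r -> `|y| <= r ->
  2 * bump r y <= bump r (y + t) + bump r (y - t) + 2 * (t / r) ^+ 2.
Proof.
move=> r0 yr; rewrite /bump !mulrDl mulNr.
have : (y / r) ^+ 2 <= 1.
  rewrite -(real_normK (num_real _)) normrM normfV (gtr0_norm r0) exprn_ile1 ?divr_ge0 ?(ltW r0)//.
  by rewrite ler_pdivrMr// mul1r.
move: (y / r) (t / r) => a b a1.
have : 1 - (a + b) ^+ 2 <= Num.max (1 - (a + b) ^+ 2) 0 by rewrite le_max lexx.
have : 1 - (a - b) ^+ 2 <= Num.max (1 - (a - b) ^+ 2) 0 by rewrite le_max lexx.
have -> : Num.max (1 - a ^+ 2) 0 = 1 - a ^+ 2 by apply/max_idPl; rewrite subr_ge0.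
lra.
Qed.

(** The nonlocal gain: from any point of the support, a jump of length between
    [r / 2] and [3 / 4 * r] towards the origin lands in [[- 3/4 r, 3/4 r]],
    where [bump r] is at least 7/16. This stays true at the ends of the
    support, where [bump r] itself vanishes. *)
Lemma bump_gain r y t : 0 < r -> `|y| <= r -> r / 2 <= t <= 3 / 4 * r ->
  7 / 16 <= bump r (y + t) + bump r (y - t).
Proof.
move=> r0 yr tr; rewrite /bump !mulrDl mulNr.
have : -1 <= y / r <= 1.
  by rewrite -ler_norml normrM normfV (gtr0_norm r0) ler_pdivrMr// mul1r.
have : 1 / 2 <= t / r <= 3 / 4.
  by rewrite ler_pdivlMr// ler_pdivrMr// mulrC mulrA mulr1.
move: (y / r) (t / r) => a b b1 a1.
have : 0 <= Num.max (1 - (a + b) ^+ 2) 0 by rewrite le_max lexx orbT.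
have : 0 <= Num.max (1 - (a - b) ^+ 2) 0 by rewrite le_max lexx orbT.
have : 1 - (a + b) ^+ 2 <= Num.max (1 - (a + b) ^+ 2) 0 by rewrite le_max lexx.
have : 1 - (a - b) ^+ 2 <= Num.max (1 - (a - b) ^+ 2) 0 by rewrite le_max lexx.
have [a0|a0] := leP 0 a.
  suff : 7 / 16 <= 1 - (a - b) ^+ 2 by lra.
  nra.
suff : 7 / 16 <= 1 - (a + b) ^+ 2 by lra.
nra.
Qed.

(** The pointwise form of L psi <= K psi before integration in [t]. Short jumps
    are charged to the indicator of the support, long ones to [bump] itself,
    and the gain, also an indicator, will pay for the short ones once [theta]
    is small. *)
Lemma bump_second_difference (theta r y t : R) :
  0 < r -> 0 < theta < 1 / 2 ->
  2 * bump r y + 7 / 16 * \1_`[r / 2, 3 / 4 * r] t * \1_`[- r, r] y <=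
  bump r (y + t) + bump r (y - t) +
  (2 * (t / r) ^+ 2 * \1_`]0, theta * r] `|t| * \1_`[- r, r] y +
   2 * \1_`[theta * r, +oo[ `|t| * bump r y).
Proof.
move=> r0 /andP[theta0 theta1].
have b0 := bump_ge0 r y.
have bp := bump_ge0 r (y + t).
have bm := bump_ge0 r (y - t).
have t20 := sqr_ge0 (t / r).
rewrite !indicE !mem_setE !in_itv/= !andbT -ler_norml.
have [yr|yr] := leP `|y| r; last first.
  rewrite bump0 ?(ltW yr)// !mulr0 !addr0; exact: addr_ge0.
rewrite !mulr1.
have h1 := bump_semiconvex t r0 yr.
have [tA|tA] := boolP (r / 2 <= t <= 3 / 4 * r); last first.
  have [tt|tt] := leP (theta * r) `|t|.
    have : 0 <= 2 * (t / r) ^+ 2 * ((0 < `|t|) && (`|t| <= theta * r))%:R.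
      by apply: mulr_ge0; [apply: mulr_ge0 => //|exact: ler0n].
    rewrite !mulr0 !mulr1 addr0; lra.
  rewrite (ltW tt) andbT normr_gt0; have [->|t0] := eqVneq t 0.
    rewrite mul0r expr0n/= subr0 addr0; lra.
  by rewrite !mulr1 !mulr0 !mul0r !addr0.
have t0 : 0 < t by case/andP : tA => /(lt_le_trans _)-> //; rewrite divr_gt0.
have h2 := bump_gain r0 yr tA.
have tt : theta * r <= `|t|.
  rewrite (gtr0_norm t0); case/andP : tA => + _; apply: le_trans.
  by rewrite mulrC ler_pM2l//; lra.
rewrite tt !mulr1.
have : 0 <= 2 * (t / r) ^+ 2 * ((0 < `|t|) && (`|t| <= theta * r))%:R.
  by apply: mulr_ge0; [apply: mulr_ge0 => //|exact: ler0n].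
lra.
Qed.

End bump.

(** * The kernel of the fractional Laplacian *)

Section kernel.
Context {R : realType}.
Local Notation mu := (@lebesgue_measure R).
Implicit Types s : R.

(** For [s > 0] this vanishes at [t = 0], the inverse of zero being zero, so the
    bounds below hold there as well. *)
Definition stable_kernel (s t : R) : R := (`|t| `^ (1 + 2 * s))^-1.

Lemma stable_kernel_ge0 s t : 0 <= stable_kernel s t.
Proof. by rewrite invr_ge0 powR_ge0. Qed.

Lemma measurable_stable_kernel s : measurable_fun [set: R] (stable_kernel s).
Proof.
rewrite (_ : stable_kernel s = (fun x => x `^ - (1 + 2 * s)) \o Num.norm).
  apply: measurableT_comp; first exact: measurable_powR.
  exact: normr_measurable.
by apply/funext => t; rewrite /stable_kernel /= powRN.
Qed.

Lemma measurable_indic_norm (i : interval R) :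
  measurable_fun [set: R] (fun t : R => \1_[set` i] `|t| : R).
Proof.
by apply: (measurableT_comp (measurable_indic _)) => //; exact: normr_measurable.
Qed.

Lemma integral_stable_kernel_near0 s (rho : R) : s < 1 -> 0 < rho ->
  (\int[mu]_t (\1_`]0%R, rho] `|t| * (t ^+ 2 * stable_kernel s t))%:E <=
   (rho `^ (2 - 2 * s) / (1 - s))%:E)%E.
Proof.
move=> s_lt1 rho0.
have c0 : 0 < 2 - 2 * s by lra.
pose g (t : R) : \bar R := (\1_`]0%R, rho] t * t `^ (2 - 2 * s - 1))%:E.
have mg : measurable_fun [set: R] g.
  apply/measurable_EFinP; apply: measurable_funM; last exact: measurable_powR.
  exact: measurable_indic.
rewrite [leLHS](_ : _ = \int[mu]_t g `|t|%R)%E; last first.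
  apply: eq_integral => t _; congr EFin.
  rewrite indicE mem_setE in_itv/=; case: (boolP (_ && _)); rewrite ?mul0r// !mul1r.
  move=> /andP[t0 _]; rewrite /stable_kernel -powRN -(real_normK (num_real _)).
  rewrite -powR_mulrn// -powRD ?(gt_eqF t0) ?implybT//; congr (_ `^ _); lra.
rewrite ge0_integral_norm//; last by move=> t; rewrite lee_fin mulr_ge0 ?powR_ge0.
rewrite [leLHS](_ : _ = 2%:E * \int[mu]_(t in `]0%R, rho]) (t `^ (2 - 2 * s - 1))%:E)%E; last first.
  congr (_ * _)%E; rewrite [LHS]integral_mkcond [RHS]integral_mkcond.
  apply: eq_integral => t _; rewrite !patchE /g indicE !mem_setE !in_itv/= andbT.
  by case: (0 < t); case: (t <= rho) => //=; rewrite ?mul1r ?mul0r.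
apply: le_trans (lee_wpmul2l _ (integral_powR_near0 c0 rho0)) _ => //.
rewrite -EFinM lee_fin le_eqVlt; apply/orP; left; apply/eqP.
field; lra.
Qed.

Lemma integral_stable_kernel_near_pinfty s (rho alpha : R) :
  0 < rho -> alpha < 2 * s ->
  (\int[mu]_t (\1_`[rho, +oo[ `|t| * (`|t| `^ alpha * stable_kernel s t))%:E <=
   (2 * rho `^ (alpha - 2 * s) / (2 * s - alpha))%:E)%E.
Proof.
move=> rho0 alphas.
have c0 : 0 < 2 * s - alpha by lra.
pose g (t : R) : \bar R :=
  (\1_`[rho, +oo[ t * t `^ (- (2 * s - alpha) - 1))%:E.
have mg : measurable_fun [set: R] g.
  apply/measurable_EFinP; apply: measurable_funM; last exact: measurable_powR.
  exact: measurable_indic.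
rewrite [leLHS](_ : _ = \int[mu]_t g `|t|%R)%E; last first.
  apply: eq_integral => t _; congr EFin.
  rewrite indicE mem_setE in_itv/= andbT; case: (leP rho); rewrite ?mul0r// !mul1r.
  move=> /(lt_le_trans rho0) t0; rewrite /stable_kernel -powRN.
  rewrite -powRD ?(gt_eqF t0) ?implybT//; congr (_ `^ _); lra.
rewrite ge0_integral_norm//; last by move=> t; rewrite lee_fin mulr_ge0 ?powR_ge0.
rewrite [leLHS](_ : _ = 2%:E * \int[mu]_(t in `[rho, +oo[)
    (t `^ (- (2 * s - alpha) - 1))%:E)%E; last first.
  congr (_ * _)%E; rewrite [LHS]integral_mkcond [RHS]integral_mkcond.
  apply: eq_integral => t _; rewrite !patchE /g indicE !mem_setE !in_itv/= !andbT.
  case: (leP rho t) => [/(lt_le_trans rho0) ->|_]; first by rewrite mul1r.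
  by case: ifP; rewrite ?mul0r.
apply: le_trans (lee_wpmul2l _ (integral_powR_near_pinfty c0 rho0)) _ => //.
by rewrite -EFinM lee_fin opprB mulrA.
Qed.

Lemma integral_stable_kernel_gain s (r : R) : 0 < s -> 0 < r ->
  ((r `^ (- (2 * s)) / 4)%:E <=
   \int[mu]_t (\1_`[r / 2, 3 / 4 * r] t * stable_kernel s t)%:E)%E.
Proof.
move=> s_gt0 r0.
have mA : measurable (`[r / 2, 3 / 4 * r]%classic : set R) by [].
apply: (@le_trans _ _
  (\int[mu]_t ((r `^ (1 + 2 * s))^-1 * \1_`[r / 2, 3 / 4 * r] t)%:E)%E).
  under eq_integral do rewrite EFinM.
  rewrite ge0_integralZl//; last 2 first.
  - by apply: measurableT_comp => //; exact: measurable_indic.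
  - by rewrite lee_fin invr_ge0 powR_ge0.
  rewrite integral_indic//= setIT lebesgue_measure_itv/= lte_fin ifT; last lra.
  rewrite -EFinB -EFinM lee_fin -powRN le_eqVlt; apply/orP; left; apply/eqP.
  rewrite (_ : 3 / 4 * r - r / 2 = r / 4); last lra.
  rewrite mulrA; congr (_ / _); rewrite -[X in _ = _ * X](powRr1 (ltW r0)) -powRD.
    by congr (_ `^ _); lra.
  by rewrite (gt_eqF r0) implybT.
apply: ge0_le_integral => //.
- by move=> t _; rewrite lee_fin mulr_ge0// invr_ge0 powR_ge0.
- by apply/measurable_EFinP; apply: measurable_funM => //; exact: measurable_indic.
- apply/measurable_EFinP; apply: measurable_funM; first exact: measurable_indic.
  exact: measurable_stable_kernel.
move=> t _; rewrite lee_fin mulrC indicE mem_setE in_itv/=.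
case: (boolP (_ && _)) => [/andP[t1 t2]|_]; last by rewrite !mul0r.
have t0 : 0 < t by rewrite (lt_le_trans _ t1)// divr_gt0.
rewrite !mul1r /stable_kernel gtr0_norm// lef_pV2 ?posrE ?powR_gt0//.
by apply: ge0_ler_powR; rewrite ?nnegrE ?ltW//; [lra|lra].
Qed.

End kernel.

(** * Testing the one-dimensional operator *)

Section line_inequality.
Context {R : realType}.
Local Notation mu := (@lebesgue_measure R).
Implicit Types (f : R -> R) (r s t y : R).

Lemma continuous_bounded f (rho : R) : continuous f ->
  exists M, forall y, `|y| <= rho -> f y <= M.
Proof.
move=> cf; have [rho0|rho0] := leP 0 rho; last first.
  by exists 0 => y /le_lt_trans/(_ rho0); rewrite normr_lt0.
have rr : - rho <= rho by rewrite ge0_cp.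
have [c _ fc] := EVT_max rr (continuous_subspaceT cf).
by exists (f c) => y yrho; apply: fc; rewrite in_itv/= -ler_norml.
Qed.

Lemma integral_bump_lty r (g : R -> R) (M : R) : 0 < r ->
  measurable_fun [set: R] g -> (forall y, 0 <= g y) ->
  (forall y, `|y| <= r -> g y <= M) -> (forall y, r < `|y| -> g y = 0) ->
  (\int[mu]_y (g y)%:E < +oo)%E.
Proof.
move=> r0 mg g0 gM gr.
have M0 : 0 <= M by apply: le_trans (gM 0 _); rewrite // normr0 ltW.
apply: (@le_lt_trans _ _ (\int[mu]_y (M * \1_`[- r, r] y)%:E)%E).
  apply: ge0_le_integralr => //.
    by apply: measurable_funM => //; exact: measurable_indic.
  move=> y; rewrite indicE mem_setE in_itv/= -ler_norml.
  by case: (leP `|y| r) => yr; rewrite ?mulr1 ?mulr0 ?gM// gr.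
rewrite ge0_integral_mulr//.
rewrite integral_indic//= setIT lebesgue_measure_itv/=.
by case: ifP => _; rewrite ?mule0 ?ltry// -EFinB -EFinM ltry.
Qed.

Definition second_difference f y t : R := 2 * f y - f (y + t) - f (y - t).

(** Transfers the second difference from [f] to [bump] for one fixed jump [t],
    by translation invariance. All terms are nonnegative, the second difference
    of [f] entering through its positive and negative parts; the terms with
    [f (y + t)] and [f (y - t)] are finite and can be cancelled. *)
Lemma line_fixed_shift (theta r t : R) f :
  0 < r -> 0 < theta < 1 / 2 -> continuous f -> (forall y, 0 <= f y) ->
  (\int[mu]_y (bump r y * Num.max (second_difference f y t) 0)%:E +
     (7 / 16 * \1_`[r / 2, 3 / 4 * r] t *
      fine (\int[mu]_y (\1_`[- r, r] y * f y)%:E))%:E <=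
   \int[mu]_y (bump r y * Num.max (- second_difference f y t) 0)%:E +
     (2 * (t / r) ^+ 2 * \1_`]0, theta * r] `|t| *
      fine (\int[mu]_y (\1_`[- r, r] y * f y)%:E) +
      2 * \1_`[theta * r, +oo[ `|t| *
      fine (\int[mu]_y (bump r y * f y)%:E))%:E)%E.
Proof.
move=> r0 th cf f0; set F := fine _; set J := fine _.
have mf : measurable_fun [set: R] f by exact: continuous_measurable_fun.
have mft (a : R) : measurable_fun [set: R] (fun y => f (y + a)).
  apply: continuous_measurable_fun => y.
  apply: (@continuous_comp _ _ _ (fun y => y + a) f); last exact: cf.
  by apply: cvgD; [exact: cvg_id|exact: cvg_cst].
have mb : measurable_fun [set: R] (bump r) := measurable_bump r.
have mbt (a : R) : measurable_fun [set: R] (fun y => bump r (y + a)).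
  by apply: (measurableT_comp mb); exact: measurable_funD.
have m1 : measurable_fun [set: R] (\1_`[- r, r] : R -> R) by exact: measurable_indic.
have b0 := bump_ge0 r.
have bfin (a : R) : (\int[mu]_y (bump r y * f (y + a))%:E < +oo)%E.
  have [M fM] := continuous_bounded (r + `|a|) cf.
  apply: (@integral_bump_lty r _ M) => //.
  - exact: measurable_funM.
  - by move=> y; rewrite mulr_ge0.
  - move=> y yr; have := fM (y + a) (le_trans (ler_normD _ _) (lerD yr (lexx _))).
    by apply: le_trans; rewrite ler_piMl// bump_le1.
  - by move=> y /ltW/(bump0 r0)->; rewrite mul0r.
have JE : (J%:E = \int[mu]_y (bump r y * f y)%:E)%E.
  rewrite fineK// ge0_fin_numE; last first.
    by apply: integral_ge0 => y _; rewrite lee_fin mulr_ge0.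
  by have := bfin 0; under eq_integral do rewrite addr0.
have FE : (F%:E = \int[mu]_y (\1_`[- r, r] y * f y)%:E)%E.
  rewrite fineK// ge0_fin_numE; last first.
    by apply: integral_ge0 => y _; rewrite lee_fin mulr_ge0.
  have [M fM] := continuous_bounded r cf.
  apply: (@integral_bump_lty r _ M) => //.
  - exact: measurable_funM.
  - by move=> y; rewrite mulr_ge0.
  - by move=> y yr; rewrite indicE mem_setE in_itv/= -ler_norml yr mul1r fM.
  - by move=> y yr; rewrite indicE mem_setE in_itv/= -ler_norml leNgt yr mul0r.
have F0 : 0 <= F by apply/fine_ge0/integral_ge0 => y _; rewrite lee_fin mulr_ge0.
have J0 : 0 <= J by apply/fine_ge0/integral_ge0 => y _; rewrite lee_fin mulr_ge0.
(* the change of variables that moves the shift from [f] to the bump *)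
have shiftE (a : R) : (\int[mu]_y (bump r y * f (y + a))%:E =
    \int[mu]_y (bump r (y - a) * f y)%:E)%E.
  rewrite -(@ge0_integral_translate R a (fun y => (bump r (y - a) * f y)%:E)).
  - by apply: eq_integral => y _; rewrite addrK.
  - by apply/measurable_EFinP; exact: measurable_funM.
  - by move=> y; rewrite lee_fin mulr_ge0// bump_ge0.
pose X : \bar R := (\int[mu]_y (bump r y * f (y + t))%:E +
                    \int[mu]_y (bump r y * f (y - t))%:E)%E.
have Xfin : X \is a fin_num.
  rewrite ge0_fin_numE; first by rewrite lte_add_pinfty.
  by apply: adde_ge0; apply: integral_ge0 => y _; rewrite lee_fin mulr_ge0.
have msd : measurable_fun [set: R] (second_difference f ^~ t).
  apply: measurable_funB => //; apply: measurable_funB => //.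
  exact: measurable_funM.
have msp : measurable_fun [set: R]
    (fun y => bump r y * Num.max (second_difference f y t) 0).
  by apply: measurable_funM => //; exact: measurable_maxr.
have msm : measurable_fun [set: R]
    (fun y => bump r y * Num.max (- second_difference f y t) 0).
  apply: measurable_funM => //; apply: measurable_maxr => //.
  exact: measurable_funN.
have max0 (z : R) : 0 <= Num.max z 0 by rewrite le_max lexx orbT.
have mbf : measurable_fun [set: R] (fun y => bump r y * f y) by exact: measurable_funM.
have m1f : measurable_fun [set: R] (fun y => \1_`[- r, r] y * f y).
  exact: measurable_funM.
have mbft (a : R) : measurable_fun [set: R] (fun y => bump r y * f (y + a)).
  exact: measurable_funM.
have mbtf (a : R) : measurable_fun [set: R] (fun y => bump r (y + a) * f y).
  exact: measurable_funM.
have scale (c : R) (g : R -> R) : measurable_fun [set: R] g ->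
    measurable_fun [set: R] (fun y => c * g y).
  by move=> mg; exact: measurable_funM.
have balance :
  (\int[mu]_y (bump r y * Num.max (second_difference f y t) 0)%:E + X =
   \int[mu]_y (bump r y * Num.max (- second_difference f y t) 0)%:E +
   2%:E * J%:E)%E.
  transitivity (\int[mu]_y (bump r y * Num.max (second_difference f y t) 0 +
     (bump r y * f (y + t) + bump r y * f (y - t)))%:E)%E.
    rewrite ge0_integral_addr//; last 3 first.
    - exact: (measurable_funD (mbft _) (mbft _)).
    - by move=> y; rewrite mulr_ge0 ?b0 ?max0.
    - by move=> y; apply: addr_ge0; exact: mulr_ge0.
    congr (_ + _)%E; rewrite [RHS]ge0_integral_addr//;
      by [exact: mbft|move=> y; rewrite mulr_ge0].
  transitivity (\int[mu]_y (bump r y * Num.max (- second_difference f y t) 0 +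
     2 * (bump r y * f y))%:E)%E; last first.
    rewrite ge0_integral_addr//; last 3 first.
    - exact: scale.
    - by move=> y; rewrite mulr_ge0 ?b0 ?max0.
    - by move=> y; rewrite !mulr_ge0.
    by rewrite ge0_integral_mulr ?JE// => y; rewrite mulr_ge0.
  apply: eq_integral => y _; congr EFin; rewrite /second_difference.
  set z := _ - _.
  have zE : Num.max z 0 - Num.max (- z) 0 = z.
    by case: (leP z 0) => z0; case: (leP (- z) 0) => z1; lra.
  rewrite (_ : Num.max z 0 = Num.max (- z) 0 + z); last lra.
  by rewrite /z; ring.
have compare :
  (2%:E * J%:E + (7 / 16 * \1_`[r / 2, 3 / 4 * r] t * F)%:E <=
   X + (2 * (t / r) ^+ 2 * \1_`]0, theta * r] `|t| * F +
      2 * \1_`[theta * r, +oo[ `|t| * J)%:E)%E.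
  have diff y := bump_second_difference y t r0 th.
  move: diff; set A := 7 / 16 * _; set B := 2 * _ * _; set C := 2 * \1_(_) _.
  have A0 : 0 <= A by rewrite mulr_ge0.
  have B0 : 0 <= B by do 2 apply: mulr_ge0 => //; exact: sqr_ge0.
  have C0 : 0 <= C by rewrite mulr_ge0.
  move: A0 B0 C0; move: A B C => A B C A0 B0 C0 diff.
  have -> : (2%:E * J%:E + (A * F)%:E =
      \int[mu]_y (2 * (bump r y * f y) + A * (\1_`[- r, r] y * f y))%:E)%E.
    rewrite ge0_integral_addr; first last.
    - by move=> y; rewrite !mulr_ge0.
    - by move=> y; rewrite !mulr_ge0.
    - exact: scale.
    - exact: scale.
    by rewrite EFinM JE FE !ge0_integral_mulr// => y; rewrite mulr_ge0.
  have -> : (X + (B * F + C * J)%:E = \int[mu]_y (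
      (bump r (y - t) * f y + bump r (y + t) * f y) +
      (B * (\1_`[- r, r] y * f y) + C * (bump r y * f y)))%:E)%E.
    rewrite ge0_integral_addr; first last.
    - by move=> y; apply: addr_ge0; rewrite !mulr_ge0.
    - by move=> y; apply: addr_ge0; rewrite mulr_ge0// bump_ge0.
    - exact: (measurable_funD (scale _ _ m1f) (scale _ _ mbf)).
    - exact: (measurable_funD (mbtf _) (mbtf _)).
    rewrite /X !shiftE opprK; congr (_ + _)%E.
      rewrite [RHS]ge0_integral_addr//;
        by [exact: mbtf|move=> y; rewrite mulr_ge0// bump_ge0].
    rewrite ge0_integral_addr; first last.
    - by move=> y; rewrite !mulr_ge0.
    - by move=> y; rewrite !mulr_ge0.
    - exact: scale.
    - exact: scale.
    by rewrite EFinD !EFinM JE FE !ge0_integral_mulr// => y; rewrite mulr_ge0.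
  apply: ge0_le_integralr.
  - exact: (measurable_funD (scale _ _ mbf) (scale _ _ m1f)).
  - exact: (measurable_funD (measurable_funD (mbtf _) (mbtf _))
      (measurable_funD (scale _ _ m1f) (scale _ _ mbf))).
  - by move=> y; apply: addr_ge0; rewrite !mulr_ge0.
  - move=> y; have /(ler_wpM2r (f0 y)) := diff y; lra.
rewrite -(leeD2rE _ _ Xfin) addeAC balance -addeA [leRHS]addeAC -[leRHS]addeA.
exact: leeD2l.
Qed.

Lemma measurable_second_difference f : measurable_fun [set: R] f ->
  measurable_fun [set: R * R] (fun z => second_difference f z.1 z.2).
Proof.
move=> mf; apply: measurable_funB; last first.
  by apply: (measurableT_comp mf); apply: measurable_funB.
apply: measurable_funB; last first.
  by apply: (measurableT_comp mf); apply: measurable_funD.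
by apply: measurable_funM => //; exact: (measurableT_comp mf).
Qed.

(** In units of r^(-2s), the left-hand side is the loss from jumps shorter than
    [theta * r], and 7/64 is the gain: height 7/16 on an interval of jumps of
    length [r / 4], where the kernel is at least r^(-1-2s). *)
Lemma small_scale s : s < 1 ->
  exists2 theta : R, 0 < theta < 1 / 2 & 2 * theta `^ (2 - 2 * s) / (1 - s) <= 7 / 64.
Proof.
move=> s1; pose c := 7 / 128 * (1 - s).
have c0 : 0 < c by rewrite mulr_gt0//; lra.
have e0 : 0 < 2 - 2 * s by lra.
exists (Num.min (1 / 4) (c `^ (2 - 2 * s)^-1)).
  by rewrite lt_min powR_gt0// gt_min; apply/andP; split; lra.
rewrite ler_pdivrMr; last lra.
suff : Num.min (1 / 4) (c `^ (2 - 2 * s)^-1) `^ (2 - 2 * s) <= c by rewrite /c; lra.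
apply: (@le_trans _ _ ((c `^ (2 - 2 * s)^-1) `^ (2 - 2 * s))).
  apply: ge0_ler_powR; rewrite ?nnegrE ?powR_ge0 ?(ltW e0)//.
    by rewrite le_min powR_ge0 andbT.
  by rewrite ge_min lexx orbT.
by rewrite -powRrM mulVf ?gt_eqF// powRr1 ?(ltW c0).
Qed.

(** Integration by parts on the line together with L psi <= K r^(-2s) psi. The
    gain and the loss from short jumps are both multiples of the integral of
    [f] over the support; [theta] is chosen so that the former dominates and
    this integral, which has no bound in terms of [bump r * f], disappears. *)
Lemma line_inequality s : 0 < s -> s < 1 -> exists2 K : R, 0 <= K &
  forall r f, 0 < r -> continuous f -> (forall y, 0 <= f y) ->
  (\int[mu]_y \int[mu]_t
      (bump r y * Num.max (second_difference f y t) 0 * stable_kernel s t)%:E <=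
   \int[mu]_y \int[mu]_t
      (bump r y * Num.max (- second_difference f y t) 0 * stable_kernel s t)%:E +
   (K * r `^ (- (2 * s)))%:E * \int[mu]_y (bump r y * f y)%:E)%E.
Proof.
move=> s0 s1; have [theta th thle] := small_scale s1.
have theta0 : 0 < theta by case/andP: th.
exists (2 * theta `^ (- (2 * s)) / s); first by rewrite divr_ge0 ?mulr_ge0 ?powR_ge0 ?(ltW s0).
move=> r f r0 cf f0.
have mf : measurable_fun [set: R] f by exact: continuous_measurable_fun.
have msd := measurable_second_difference mf.
have mb := measurable_bump r.
have mk := measurable_stable_kernel s.
have k0 := stable_kernel_ge0 s.
have b0 := bump_ge0 r.
have max0 (z : R) : 0 <= Num.max z 0 by rewrite le_max lexx orbT.
pose p (z : R * R) := bump r z.1 * Num.max (second_difference f z.1 z.2) 0 *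
  stable_kernel s z.2.
pose q (z : R * R) := bump r z.1 * Num.max (- second_difference f z.1 z.2) 0 *
  stable_kernel s z.2.
have p0 z : (0 <= (p z)%:E)%E by rewrite lee_fin !mulr_ge0.
have q0 z : (0 <= (q z)%:E)%E by rewrite lee_fin !mulr_ge0.
have mp : measurable_fun [set: R * R] (EFin \o p).
  apply/measurable_EFinP; apply: measurable_funM; last exact: (measurableT_comp mk).
  apply: measurable_funM; first exact: (measurableT_comp mb).
  exact: measurable_maxr.
have mq : measurable_fun [set: R * R] (EFin \o q).
  apply/measurable_EFinP; apply: measurable_funM; last exact: (measurableT_comp mk).
  apply: measurable_funM; first exact: (measurableT_comp mb).
  by apply: measurable_maxr => //; exact: measurable_funN.
pose fubini := @fubini_tonelli _ _ (measurableTypeR R) (measurableTypeR R) R mu mu.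
set PP := (X in (X <= _)%E); set QQ := (X in (_ <= X + _)%E).
have -> : PP = _ := fubini (EFin \o p) mp p0.
have -> : QQ = _ := fubini (EFin \o q) mq q0.
set F := fine (\int[mu]_y (\1_`[- r, r] y * f y)%:E).
set J := fine (\int[mu]_y (bump r y * f y)%:E).
have F0 : 0 <= F by apply/fine_ge0/integral_ge0 => y _; rewrite lee_fin mulr_ge0.
have J0 : 0 <= J by apply/fine_ge0/integral_ge0 => y _; rewrite lee_fin mulr_ge0.
have JE : (J%:E <= \int[mu]_y (bump r y * f y)%:E)%E.
  rewrite /J; have : (0 <= \int[mu]_y (bump r y * f y)%:E)%E.
    by apply: integral_ge0 => y _; rewrite lee_fin mulr_ge0.
  by case: (\int[mu]_y _)%E => //= x _; exact: leey.
have msdt t : measurable_fun [set: R] (second_difference f ^~ t).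
  exact: (measurableT_comp msd (measurable_pair2 t)).
have fixed t : (\int[mu]_y (p (y, t))%:E +
    ((7 / 16 * F) * (\1_`[r / 2, 3 / 4 * r] t * stable_kernel s t))%:E <=
  \int[mu]_y (q (y, t))%:E +
    ((2 / r ^+ 2 * F) * (\1_`]0, theta * r] `|t| * (t ^+ 2 * stable_kernel s t)) +
     (2 * J) * (\1_`[theta * r, +oo[ `|t| * (`|t| `^ 0 * stable_kernel s t)))%:E)%E.
  have kt0 := k0 t.
  have -> : (\int[mu]_y (p (y, t))%:E = (stable_kernel s t)%:E *
      \int[mu]_y (bump r y * Num.max (second_difference f y t) 0)%:E)%E.
    rewrite -ge0_integral_mulr//.
    - by apply: eq_integral => y _; rewrite /p /= mulrC.
    - by apply: measurable_funM => //; apply: measurable_maxr => //; exact: msdt.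
    - by move=> y; rewrite mulr_ge0.
  have -> : (\int[mu]_y (q (y, t))%:E = (stable_kernel s t)%:E *
      \int[mu]_y (bump r y * Num.max (- second_difference f y t) 0)%:E)%E.
    rewrite -ge0_integral_mulr//.
    - by apply: eq_integral => y _; rewrite /q /= mulrC.
    - apply: measurable_funM => //; apply: measurable_maxr => //.
      exact: (measurable_funN (msdt t)).
    - by move=> y; rewrite mulr_ge0.
  have := line_fixed_shift t r0 th cf f0; rewrite -/F -/J.
  move/(@lee_wpmul2l _ (stable_kernel s t)%:E); rewrite lee_fin => /(_ kt0).
  have P0 : (0 <= \int[mu]_y (bump r y * Num.max (second_difference f y t) 0)%:E)%E.
    by apply: integral_ge0 => y _; rewrite lee_fin mulr_ge0.
  have Q0 : (0 <= \int[mu]_y (bump r y * Num.max (- second_difference f y t) 0)%:E)%E.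
    by apply: integral_ge0 => y _; rewrite lee_fin mulr_ge0.
  rewrite (ge0_muleDr _ P0); last by rewrite lee_fin !mulr_ge0.
  rewrite (ge0_muleDr _ Q0); last first.
    rewrite lee_fin; apply: addr_ge0; last by rewrite !mulr_ge0.
    by do 3 apply: mulr_ge0 => //; exact: sqr_ge0.
  rewrite -!EFinM powRr0 mul1r.
  congr (_ + _%:E <= _ + _%:E)%E; first by ring.
  by rewrite expr_div_n; ring.
pose gA t : R := \1_`[r / 2, 3 / 4 * r] t * stable_kernel s t.
pose gn t : R := \1_`]0, theta * r] `|t| * (t ^+ 2 * stable_kernel s t).
pose gf t : R := \1_`[theta * r, +oo[ `|t| * (`|t| `^ 0 * stable_kernel s t).
have gA0 t : 0 <= gA t by rewrite mulr_ge0.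
have gn0 t : 0 <= gn t by do 2 apply: mulr_ge0 => //; exact: sqr_ge0.
have gf0 t : 0 <= gf t by do 2 apply: mulr_ge0 => //; exact: powR_ge0.
have mn : measurable_fun [set: R] (Num.norm : R -> R) by exact: normr_measurable.
have mgA : measurable_fun [set: R] gA.
  by apply: measurable_funM => //; exact: measurable_indic.
have mgn : measurable_fun [set: R] gn.
  apply: measurable_funM; first exact: measurable_indic_norm.
  by apply: measurable_funM => //; exact: exprn_measurable.
have mgf : measurable_fun [set: R] gf.
  apply: measurable_funM; first exact: measurable_indic_norm.
  apply: measurable_funM => //.
  by rewrite (_ : (fun _ => _) = cst 1)//; apply/funext => t; exact: powRr0.
have c1 : 0 <= 7 / 16 * F by rewrite mulr_ge0.
have c2 : 0 <= 2 / r ^+ 2 * F by rewrite mulr_ge0// divr_ge0// sqr_ge0.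
have c3 : 0 <= 2 * J by rewrite mulr_ge0.
have scale (c : R) (g : R -> R) : measurable_fun [set: R] g ->
    measurable_fun [set: R] (fun y => c * g y).
  by move=> mg; exact: measurable_funM.
have mP : measurable_fun [set: R] (fun t => \int[mu]_y (p (y, t))%:E)%E.
  exact: (@measurable_fun_fubini_tonelli_G _ _ (measurableTypeR R)
    (measurableTypeR R) R mu (EFin \o p)).
have mQ : measurable_fun [set: R] (fun t => \int[mu]_y (q (y, t))%:E)%E.
  exact: (@measurable_fun_fubini_tonelli_G _ _ (measurableTypeR R)
    (measurableTypeR R) R mu (EFin \o q)).
have outZ (c : R) (g : R -> R) : measurable_fun [set: R] g -> (forall t, 0 <= g t) ->
    0 <= c -> (c%:E * \int[mu]_t (g t)%:E = \int[mu]_t (c * g t)%:E)%E.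
  by move=> mg g0 c0; rewrite ge0_integral_mulr.
have integrated : (\int[mu]_t \int[mu]_y (p (y, t))%:E +
    (7 / 16 * F)%:E * \int[mu]_t (gA t)%:E <=
  \int[mu]_t \int[mu]_y (q (y, t))%:E +
    ((2 / r ^+ 2 * F)%:E * \int[mu]_t (gn t)%:E +
     (2 * J)%:E * \int[mu]_t (gf t)%:E))%E.
  rewrite !outZ// -ge0_integral_addr; first last.
  - by move=> t; rewrite mulr_ge0.
  - by move=> t; rewrite mulr_ge0.
  - exact: scale.
  - exact: scale.
  rewrite -[leLHS]ge0_integralD// -?[leRHS]ge0_integralD//; first last.
  - by apply/measurable_EFinP; apply: scale.
  - by move=> t _; rewrite lee_fin mulr_ge0.
  - by move=> t _; apply: integral_ge0 => y _.
  - by apply/measurable_EFinP; apply: measurable_funD; exact: scale.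
  - by move=> t _; rewrite lee_fin addr_ge0// mulr_ge0.
  - by move=> t _; apply: integral_ge0 => y _.
  apply: ge0_le_integral => //.
  - move=> t _; apply: adde_ge0; first by apply: integral_ge0 => y _.
    by rewrite lee_fin mulr_ge0.
  - by apply: emeasurable_funD => //; apply/measurable_EFinP; exact: scale.
  - apply: emeasurable_funD => //; apply/measurable_EFinP.
    by apply: measurable_funD; exact: scale.
have rs0 := powR_ge0 r (- (2 * s)).
have gain : ((7 / 64 * r `^ (- (2 * s)) * F)%:E <=
    (7 / 16 * F)%:E * \int[mu]_t (gA t)%:E)%E.
  apply: le_trans (lee_wpmul2l _ (integral_stable_kernel_gain s0 r0)).
    by rewrite -EFinM lee_fin; lra.
  by rewrite lee_fin.
have tr0 : 0 < theta * r by rewrite mulr_gt0.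
have lossn : ((2 / r ^+ 2 * F)%:E * \int[mu]_t (gn t)%:E <=
    (7 / 64 * r `^ (- (2 * s)) * F)%:E)%E.
  apply: le_trans (lee_wpmul2l _ (integral_stable_kernel_near0 s1 tr0)) _.
    by rewrite lee_fin.
  rewrite -EFinM lee_fin mulrAC ler_wpM2r// powRM ?(ltW r0) ?(ltW theta0)//.
  have -> : r `^ (2 - 2 * s) = r ^+ 2 * r `^ (- (2 * s)).
    by rewrite -powR_mulrn ?(ltW r0)// -powRD// (gt_eqF r0) implybT.
  rewrite (_ : 2 / r ^+ 2 * _ =
      (2 * theta `^ (2 - 2 * s) / (1 - s)) * r `^ (- (2 * s))).
    exact: ler_wpM2r.
  field; lra.
have lossf : ((2 * J)%:E * \int[mu]_t (gf t)%:E <=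
    (2 * theta `^ (- (2 * s)) / s * r `^ (- (2 * s)))%:E * J%:E)%E.
  have s20 : 0 < 2 * s by lra.
  apply: le_trans (lee_wpmul2l _ (integral_stable_kernel_near_pinfty tr0 s20)) _.
    by rewrite lee_fin.
  rewrite -!EFinM lee_fin sub0r subr0 powRM ?(ltW r0) ?(ltW theta0)//.
  by rewrite le_eqVlt; apply/orP; left; apply/eqP; field; lra.
have c_fin : (7 / 64 * r `^ (- (2 * s)) * F)%:E \is a fin_num by [].
rewrite -(leeD2rE _ _ c_fin); apply: le_trans (leeD2l _ gain) _.
apply: le_trans integrated _; rewrite -[leRHS]addeA; apply: leeD2l.
rewrite [leRHS]addeC; apply: leeD lossn _.
apply: le_trans lossf _; apply: lee_wpmul2l JE.
by rewrite lee_fin mulr_ge0// divr_ge0 ?mulr_ge0 ?powR_ge0 ?(ltW s0).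
Qed.

End line_inequality.

(** * Slices and cubes for N-dimensional Lebesgue measure *)

Section lebesgueN_slices.
Context {R : realType}.
Local Notation RT := (measurableTypeR R).
Local Notation mu := (@lebesgue_measure R).
Local Open Scope ereal_scope.

Definition tupd (n : nat) (i : 'I_n) (x : n.-tuple RT) (y : R) : n.-tuple RT :=
  [tuple if j == i then y else tnth x j | j < n].

Lemma tnth_tupd n (i : 'I_n) x y j :
  tnth (tupd i x y) j = if j == i then y else tnth x j.
Proof. by rewrite tnth_mktuple. Qed.

Lemma tupd_cons0 n (a : RT) (t : n.-tuple RT) y :
  tupd ord0 [tuple of a :: t] y = [tuple of y :: t].
Proof.
apply: eq_from_tnth => j; rewrite tnth_tupd; case: (unliftP ord0 j) => [k|] ->.
  by rewrite !tnthS.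
by rewrite eqxx.
Qed.

Lemma tupd_consS n (i : 'I_n) (a : RT) (t : n.-tuple RT) y :
  tupd (lift ord0 i) [tuple of a :: t] y = [tuple of a :: tupd i t y].
Proof.
apply: eq_from_tnth => j; rewrite tnth_tupd; case: (unliftP ord0 j) => [k|] ->.
  by rewrite !tnthS tnth_tupd (inj_eq lift_inj).
by [].
Qed.

Lemma ge0_integral_lebesgueNS n (F : n.+1.-tuple RT -> \bar R) :
  measurable_fun [set: _] F -> (forall x, 0 <= F x) ->
  \int[lebesgueN R n.+1]_x F x =
  \int[mu]_a \int[lebesgueN R n]_t F [tuple of a :: t].
Proof.
move=> mF F0.
transitivity (\int[mu \x lebesgueN R n]_z F (tuple_of_pair z)).
  rewrite -(preimage_setT (@tuple_of_pair R n)).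
  by rewrite -(@ge0_integral_pushforward _ _ (RT * n.-tuple RT)%type (n.+1.-tuple RT)
    R (@tuple_of_pair R n) (@measurable_tuple_of_pair R n) (mu \x lebesgueN R n)
    setT F).
rewrite (fubini_tonelli1 (F \o @tuple_of_pair R n))//; last by move=> z; exact: F0.
by apply: measurableT_comp => //; exact: measurable_tuple_of_pair.
Qed.

(** Replaces a permutation of the variables in an iterated integral: the
    measure is built coordinate by coordinate, so only the induction step in
    which [i] is the first coordinate has to exchange two integrals. *)
Lemma lebesgueN_slice_le n (i : 'I_n) (A B : n.-tuple RT -> \bar R) :
  measurable_fun [set: _] A -> measurable_fun [set: _] B ->
  (forall x, 0 <= A x) -> (forall x, 0 <= B x) ->
  (forall x, \int[mu]_y A (tupd i x y) <= \int[mu]_y B (tupd i x y)) ->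
  \int[lebesgueN R n]_x A x <= \int[lebesgueN R n]_x B x.
Proof.
elim: n i A B => [[]//|n IHn] i A B mA mB A0 B0 AB.
have mcons : measurable_fun [set: RT * n.-tuple RT] (@tuple_of_pair R n).
  exact: measurable_tuple_of_pair.
have mF (F : n.+1.-tuple RT -> \bar R) : measurable_fun [set: _] F ->
    measurable_fun [set: RT * n.-tuple RT] (F \o @tuple_of_pair R n).
  by move=> mF; exact: measurableT_comp.
have mslice (F : n.+1.-tuple RT -> \bar R) : measurable_fun [set: _] F ->
    (forall x, 0 <= F x) ->
    measurable_fun [set: RT] (fun a => \int[lebesgueN R n]_t F [tuple of a :: t]) /\
    measurable_fun [set: n.-tuple RT] (fun t => \int[mu]_a F [tuple of a :: t]).
  move=> mF' F0; split.
    exact: (measurable_fun_fubini_tonelli_F (F \o @tuple_of_pair R n)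
      (mF _ mF') (fun z => F0 _)).
  exact: (measurable_fun_fubini_tonelli_G (F \o @tuple_of_pair R n)
    (mF _ mF') (fun z => F0 _)).
have [mA1 mA2] := mslice _ mA A0; have [mB1 mB2] := mslice _ mB B0.
rewrite !ge0_integral_lebesgueNS//.
case: (unliftP ord0 i) AB => [j|] -> AB.
  apply: ge0_le_integral => //.
  - by move=> a _; exact: integral_ge0.
  move=> a _; apply: (IHn j) => //.
  - exact: (measurableT_comp (mF _ mA) (measurable_pair1 a)).
  - exact: (measurableT_comp (mF _ mB) (measurable_pair1 a)).
  - by move=> x; have := AB [tuple of a :: x]; under eq_integral do rewrite tupd_consS;
      under [X in _ <= X -> _]eq_integral do rewrite tupd_consS.
rewrite (fubini_tonelli (A \o @tuple_of_pair R n) (mF _ mA) (fun z => A0 _)).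
rewrite (fubini_tonelli (B \o @tuple_of_pair R n) (mF _ mB) (fun z => B0 _)).
apply: ge0_le_integral => //.
- by move=> t _; apply: integral_ge0 => a _; exact: A0.
- move=> t _; have := AB [tuple of 0%R :: t]; under eq_integral do rewrite tupd_cons0.
  by under [X in _ <= X -> _]eq_integral do rewrite tupd_cons0.
Qed.

Definition cube n (c : n.-tuple RT) (r : R) : set (n.-tuple RT) :=
  [set x | forall i, (`|tnth c i - tnth x i| < r)%R].

Lemma measurable_cube n (c : n.-tuple RT) r : measurable (cube c r).
Proof.
rewrite (_ : cube c r = \bigcap_(i in [set: 'I_n])
    ((fun x : n.-tuple RT => tnth x i) @^-1` ball (tnth c i) r)); last first.
  by apply/seteqP; split=> [x xc i _|x xc i]; [exact: xc|exact: xc i Logic.I].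
apply: fin_bigcap_measurable => // i _.
by rewrite -[X in measurable X]setTI; apply: measurable_tnth => //; exact: measurable_ball.
Qed.

Lemma lebesgueN_cube n (c : n.-tuple RT) r : (0 <= r)%R ->
  lebesgueN R n (cube c r) = ((r *+ 2) ^+ n)%:E.
Proof.
move=> r0; elim: n c => [|n IHn] c.
  by rewrite /= diracE mem_set// => -[].
rewrite [LHS](_ : _ = (mu \x lebesgueN R n)
    (ball (thead c) r `*` cube [tuple of behead c] r)).
  rewrite product_measure1E//=; [|exact: measurable_ball|exact: measurable_cube].
  by rewrite lebesgue_measure_ball// IHn -EFinM exprS.
rewrite /= /lebesgue_step /pushforward; congr (_ _).
have beheadE (i : 'I_n) : tnth [tuple of behead c] i = tnth c (lift ord0 i).
  by rewrite tnth_behead; congr tnth; apply/val_inj; rewrite /= inordK /bump//= ltnS.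
apply/seteqP; split => -[a t] /=.
  move=> H; split; first exact: (H ord0).
  by move=> i; have := H (lift ord0 i); rewrite beheadE tnthS.
move=> [H0 H] i; case: (unliftP ord0 i) => [j|] ->; last exact: H0.
by have := H j; rewrite beheadE tnthS.
Qed.

End lebesgueN_slices.

(** * Second differences near the diagonal and at infinity *)

Section local_bounds.
Context {R : realType} {N : nat}.
Implicit Types (u : 'rV[R]_N -> R) (x e : 'rV[R]_N).

Lemma is_derive_line u x e (t : R) : derivable u (x + t *: e) e ->
  is_derive t 1 (fun t => u (x + t *: e)) ('D_e u (x + t *: e)).
Proof.
move=> du.
have E : (fun h : R => h^-1 *: (((fun t => u (x + t *: e)) \o shift t) (h *: 1) -
           u (x + t *: e))) =
         (fun h : R => h^-1 *: ((u \o shift (x + t *: e)) (h *: e) - u (x + t *: e))).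
  apply/funext => h /=; congr (_ *: (u _ - _)).
  by rewrite /shift /= /GRing.scale/= mulr1 -/(GRing.scale _ _) scalerDl addrCA.
apply: DeriveDef.
  by move: du; rewrite /derivable -E.
by rewrite /derive E.
Qed.

(** Two applications of the mean value theorem, to [f z + f (- z)] and then
    to [f']. *)
Lemma second_difference_le (f f' f'' : R -> R) (L t : R) :
  (forall z : R, is_derive z 1 f (f' z)) -> (forall z : R, is_derive z 1 f' (f'' z)) ->
  (forall z, `|z| <= 1 -> `|f'' z| <= L) -> `|t| <= 1 ->
  `|second_difference f 0 t| <= 2 * L * t ^+ 2.
Proof.
move=> df df' f''L; rewrite /second_difference add0r sub0r.
(* both sides are even in [t] *)
wlog t0 : t / 0 < t.
  move=> wl t1; have [t0|t0|->] := ltgtP t 0; last 2 first.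
  - exact: wl.
  - by rewrite oppr0 expr0n mulr0 (_ : _ - _ = 0) ?normr0//; ring.
  have := wl (- t); rewrite opprK sqrrN normrN oppr_gt0 => /(_ t0 t1).
  by rewrite addrAC.
move=> t1; rewrite gtr0_norm// in t1.
have cont (g g' : R -> R) (a b : R) : (forall z : R, is_derive z 1 g (g' z)) ->
    {within `[a, b], continuous g}.
  move=> dg; apply: derivable_within_continuous => z _.
  by have [] := dg z.
pose G z := f z + f (- z).
have dG (z : R) : is_derive z 1 G (f' z - f' (- z)).
  have dN : is_derive z 1 (f \o -%R) (f' (- z) * -1).
    by apply: is_derive1_comp; exact: df.
  by rewrite -mulrN1; exact: is_deriveD.
have [xi + GE] := MVT t0 (fun z _ => dG z) (cont _ _ _ _ dG).
rewrite in_itv/= => /andP[xi0 xit].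
have xiN : - xi < xi by rewrite gtrN.
have [eta + fE] := MVT xiN (fun z _ => df' z) (cont _ _ _ _ df').
rewrite in_itv/= => /andP[eta0 eta1].
have etaL : `|f'' eta| <= L.
  by apply: f''L; rewrite ler_norml; apply/andP; split; lra.
rewrite fE /G subr0 oppr0 in GE.
have -> : 2 * f 0 - f t - f (- t) = - (f'' eta * (xi - - xi) * t).
  by rewrite -GE; ring.
rewrite normrN opprK normrM normrM (gtr0_norm t0) (_ : `|xi + xi| = 2 * xi); last first.
  by rewrite gtr0_norm; [ring|lra].
have h : `|f'' eta| * xi <= L * t by apply: ler_pM => //; exact: ltW.
rewrite (_ : _ * _ * t = 2 * (`|f'' eta| * xi) * t); last by ring.
rewrite (_ : 2 * L * _ = 2 * (L * t) * t); last by ring.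
by rewrite ler_pM2r// ler_pM2l.
Qed.

Lemma compact_slab (rho : R) :
  compact [set v : 'rV[R]_N | forall j, `|v ord0 j| <= rho].
Proof.
rewrite (_ : mkset _ = [set v : 'rV[R]_N | forall j, `[- rho, rho]%classic (v ord0 j)]).
  apply: (@rV_compact R N (fun=> `[- rho, rho]%classic)) => j.
  exact: segment_compact.
by apply/seteqP; split=> v /= vr j; have := vr j; rewrite in_itv/= -ler_norml.
Qed.

Lemma continuous_slab_bounded u (rho : R) : continuous u ->
  exists2 L, 0 <= L & forall x, (forall j, `|x ord0 j| <= rho) -> `|u x| <= L.
Proof.
move=> cu.
have := @compact_bounded R R _ (continuous_compact (continuous_subspaceT cu)
  (@compact_slab rho)).
move=> [M [_ uM]]; exists (`|M| + 1); first by rewrite addr_ge0.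
move=> x xr; apply: uM; first by rewrite (le_lt_trans (ler_norm M))// ltrDl.
by exists x.
Qed.

Lemma C2_second_difference u (i : 'I_N) (rho : R) : Ck 2 u ->
  exists2 L, 0 <= L & forall x t, (forall j, `|x ord0 j| <= rho) -> `|t| <= 1 ->
    `|2 * u x - u (x + t *: ebase i) - u (x - t *: ebase i)| <= L * t ^+ 2.
Proof.
move=> [_ /(_ i)[du [_ /(_ i)[ddu [cddu _]]]]].
have [L L0 uL] := continuous_slab_bounded (rho + 1) cddu.
exists (2 * L); first by rewrite mulr_ge0.
move=> x t xr t1.
pose f z := u (x + z *: ebase i).
have fE : second_difference f 0 t = 2 * u x - u (x + t *: ebase i) - u (x - t *: ebase i).
  by rewrite /second_difference /f scale0r addr0 add0r sub0r scaleNr.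
rewrite -fE; apply: (@second_difference_le f
  (fun z => 'D_(ebase i) u (x + z *: ebase i))
  (fun z => 'D_(ebase i) ('D_(ebase i) u) (x + z *: ebase i))).
- by move=> z; exact: is_derive_line.
- by move=> z; exact: is_derive_line.
- move=> z z1; apply: uL => j; rewrite !mxE; apply: le_trans (ler_normD _ _) _.
  rewrite lerD// normrM; case: (_ && _); last by rewrite normr0 mulr0.
  by rewrite normr1 mulr1.
- exact: t1.
Qed.

End local_bounds.

Section growth.
Context {R : realType} {N : nat}.
Implicit Types (u : 'rV[R]_N -> R) (x e : 'rV[R]_N).

Lemma enorm_le_sum x : enorm x <= \sum_(j < N) `|x ord0 j|.
Proof.
have S0 (P : pred 'I_N) : 0 <= \sum_(j < N | P j) `|x ord0 j| by exact: sumr_ge0.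
rewrite -[leRHS]ger0_norm// -sqrtr_sqr ler_wsqrtr//.
rewrite expr2 mulr_suml; apply: ler_sum => j _.
rewrite -(real_normK (num_real _)) expr2 ler_wpM2l// (bigD1 j)//= lerDl.
exact: S0.
Qed.

Lemma coord_le_enorm x j : `|x ord0 j| <= enorm x.
Proof.
rewrite -sqrtr_sqr ler_wsqrtr// (bigD1 j)//= lerDl.
by apply: sumr_ge0 => k _; exact: sqr_ge0.
Qed.

(** The exponent [alpha] is [2 * s - delta], which [delta <= 2 * s] keeps
    nonnegative and [delta > 0] keeps integrable against the kernel. *)
Lemma Ls_near_infinity s u : Ls s u -> exists2 alpha, 0 <= alpha < 2 * s &
  exists M C, [/\ 0 < M, 0 <= C & forall x, M < enorm x ->
    `|u x| <= C * enorm x `^ alpha].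
Proof.
move=> [_ [delta /andP[d0 ds]]].
rewrite limf_esupE => /ereal_inf_lt[_ [V [M _ MV] <-] supV].
exists (2 * s - delta); first by apply/andP; split; lra.
have [C CV] : exists C : R, forall x, V x -> `|u x| / enorm x `^ (2 * s - delta) <= C.
  have : forall x, V x -> ((`|u x| / enorm x `^ (2 * s - delta))%:E <=
      ereal_sup [set (`|u x| / enorm x `^ (2 * s - delta))%:E | x in V])%E.
    by move=> x Vx; apply: ereal_sup_ubound; exists x.
  move: supV; case: (ereal_sup _) => [c _ uc|//|_ uc].
    by exists c => x Vx; rewrite -lee_fin uc.
  by exists 0 => x Vx; have := uc x Vx.
exists (Num.max M 1), `|C|; split => //; first by rewrite lt_max ltr01 orbT.
move=> x; rewrite gt_max => /andP[Mx x1].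
have x0 : 0 < enorm x by apply: lt_trans x1.
rewrite -ler_pdivrMr ?powR_gt0//; apply: le_trans (ler_norm C).
exact/CV/MV.
Qed.

(** Where the shifted point leaves the region governed by the growth condition
    it stays in a compact slab; there a constant bound is enough, because
    [`|t| `^ alpha >= 1]. *)
Lemma Ls_growth s u (rho : R) : continuous u -> Ls s u -> 0 <= rho ->
  exists2 alpha, 0 <= alpha < 2 * s & exists2 C, 0 <= C &
    forall (i : 'I_N) x t, (forall j, `|x ord0 j| <= rho) -> 1 <= `|t| ->
      `|u (x + t *: ebase i)| <= C * `|t| `^ alpha.
Proof.
move=> cu /Ls_near_infinity[alpha alpha0 [M [C [M0 C0 uC]]]] rho0.
exists alpha => //; have {alpha0} alpha0 : 0 <= alpha by case/andP: alpha0.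
have [L L0 uL] := continuous_slab_bounded M cu.
have K0 : 0 <= N%:R * rho + 1 by rewrite addr_ge0// mulr_ge0.
exists (L + C * (N%:R * rho + 1) `^ alpha).
  by rewrite addr_ge0// mulr_ge0// powR_ge0.
move=> i x t xr t1; rewrite mulrDl.
have ta1 : 1 <= `|t| `^ alpha.
  by rewrite -(powRr0 `|t|) ler_powR.
have [yM|yM] := leP (enorm (x + t *: ebase i)) M.
  rewrite ler_wpDr ?mulr_ge0 ?powR_ge0//; apply: (@le_trans _ _ L); last first.
    by rewrite ler_peMr.
  by apply: uL => j; exact: le_trans (coord_le_enorm _ j) yM.
rewrite ler_wpDl ?mulr_ge0 ?powR_ge0//; apply: le_trans (uC _ yM) _.
rewrite -mulrA ler_wpM2l// -powRM//.
apply: ge0_ler_powR; rewrite ?nnegrE ?sqrtr_ge0 ?mulr_ge0//.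
apply: le_trans (enorm_le_sum _) _.
apply: (@le_trans _ _ (\sum_(j < N) (rho + (j == i)%:R * `|t|))).
  apply: ler_sum => j _; rewrite !mxE; apply: le_trans (ler_normD _ _) _.
  by rewrite lerD// normrM mulrC eqxx/= normr_nat.
rewrite big_split/= sumr_const card_ord (bigD1 i)//= eqxx mul1r big1 => [|j /negbTE->];
  last by rewrite mul0r.
rewrite addr0 mulrDl mul1r lerD2r -[leLHS]mulr_natl ler_peMr//.
by rewrite mulr_ge0.
Qed.

End growth.

(** * Testing along the coordinate axes *)

Section space_inequality.
Context {R : realType}.
Local Notation RT := (measurableTypeR R).
Local Notation mu := (@lebesgue_measure R).

Definition posr (z : R) : R := Num.max z 0.
Definition negr (z : R) : R := Num.max (- z) 0.

Definition weight (n : nat) (r : R) (x : n.-tuple RT) : R :=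
  \prod_(i < n) bump r (tnth x i).

Definition axis_second_difference (n : nat) (U : n.-tuple RT -> R) (i : 'I_n)
    (x : n.-tuple RT) (t : R) : R :=
  second_difference (fun y => U (tupd i x y)) (tnth x i) t.

(** With [phi] the positive or the negative part and [U] the function [u] read
    on tuples, this is, up to the factor [Cs s / 2], the integral of that part
    of the integrand of [- Ii s i u]. Being nonnegative, the two parts obey
    Tonelli's theorem without integrability conditions. *)
Definition axis_integral (phi : R -> R) (s : R) (n : nat) (U : n.-tuple RT -> R)
    (i : 'I_n) (x : n.-tuple RT) : \bar R :=
  (\int[mu]_t (phi (axis_second_difference U i x t) * stable_kernel s t)%:E)%E.

Lemma posr_ge0 z : 0 <= posr z. Proof. by rewrite le_max lexx orbT. Qed.
Lemma negr_ge0 z : 0 <= negr z. Proof. by rewrite le_max lexx orbT. Qed.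

Lemma measurable_posr : measurable_fun [set: R] posr.
Proof. exact: measurable_maxr. Qed.

Lemma measurable_negr : measurable_fun [set: R] negr.
Proof. by apply: measurable_maxr => //; exact: oppr_measurable. Qed.

Lemma tupd_same n (i : 'I_n) (x : n.-tuple RT) y z :
  tupd i (tupd i x y) z = tupd i x z.
Proof.
by apply: eq_from_tnth => j; rewrite !tnth_tupd; case: eqP.
Qed.

Lemma measurable_tupd n (i : 'I_n) (x : n.-tuple RT) :
  measurable_fun [set: RT] (tupd i x).
Proof.
apply/measurable_fun_tnthP => j.
rewrite (_ : _ \o _ = fun y => if j == i then y else tnth x j).
  by case: (j == i) => //; exact: measurable_id.
by apply/funext => y; rewrite /= tnth_tupd.
Qed.

Lemma weight_ge0 n r (x : n.-tuple RT) : 0 <= weight r x.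
Proof. by apply: prodr_ge0 => i _; exact: bump_ge0. Qed.

Lemma weight_tupd n r (i : 'I_n) (x : n.-tuple RT) y :
  weight r (tupd i x y) = (\prod_(j < n | j != i) bump r (tnth x j)) * bump r y.
Proof.
rewrite /weight (bigD1 i)//= tnth_tupd eqxx mulrC; congr (_ * _).
by apply: eq_bigr => j /negbTE ji; rewrite tnth_tupd ji.
Qed.

Lemma measurable_weight n r : measurable_fun [set: n.-tuple RT] (weight r).
Proof.
apply: measurable_prod => i _.
exact: (measurableT_comp (measurable_bump r) (@measurable_tnth _ RT n i)).
Qed.

Lemma measurable_axis_second_difference n (U : n.-tuple RT -> R) i :
  measurable_fun [set: n.-tuple RT] U ->
  measurable_fun [set: n.-tuple RT * RT]
    (fun z => axis_second_difference U i z.1 z.2).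
Proof.
move=> mU.
have mcoord j : measurable_fun [set: n.-tuple RT * RT] (fun z => tnth z.1 j : R).
  exact: (measurableT_comp (@measurable_tnth _ RT n j) measurable_fst).
have mupd (g : n.-tuple RT * RT -> R) : measurable_fun [set: n.-tuple RT * RT] g ->
    measurable_fun [set: n.-tuple RT * RT] (fun z => U (tupd i z.1 (g z))).
  move=> mg; apply: (measurableT_comp mU); apply/measurable_fun_tnthP => j.
  rewrite (_ : _ \o _ = fun z => if j == i then g z else tnth z.1 j); last first.
    by apply/funext => z; rewrite /= tnth_tupd.
  by case: (j == i); [exact: mg|exact: mcoord].
have msnd : measurable_fun [set: n.-tuple RT * RT] (fun z => z.2 : R).
  exact: measurable_snd.
apply: measurable_funB; [apply: measurable_funB|].
- apply: measurable_funM => //; exact: (mupd (fun z => tnth z.1 i)).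
- exact: (mupd (fun z => tnth z.1 i + z.2) (measurable_funD (mcoord i) msnd)).
- exact: (mupd (fun z => tnth z.1 i - z.2) (measurable_funB (mcoord i) msnd)).
Qed.

Lemma axis_integral_ge0 (phi : R -> R) s n (U : n.-tuple RT -> R) i x :
  (forall z, 0 <= phi z) -> (0 <= axis_integral phi s U i x)%E.
Proof.
move=> phi0; apply: integral_ge0 => t _; rewrite lee_fin mulr_ge0//.
exact: stable_kernel_ge0.
Qed.

Lemma measurable_axis_integral (phi : R -> R) s n (U : n.-tuple RT -> R) i :
  measurable_fun [set: R] phi -> (forall z, 0 <= phi z) ->
  measurable_fun [set: n.-tuple RT] U ->
  measurable_fun [set: n.-tuple RT] (axis_integral phi s U i).
Proof.
move=> mphi phi0 mU.
pose h (z : n.-tuple RT * RT) : \bar R :=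
  (phi (axis_second_difference U i z.1 z.2) * stable_kernel s z.2)%:E.
apply: (measurable_fun_fubini_tonelli_F h).
  apply/measurable_EFinP; apply: measurable_funM.
    exact: (measurableT_comp mphi (measurable_axis_second_difference i mU)).
  exact: (measurableT_comp (measurable_stable_kernel s) measurable_snd).
by move=> z; rewrite lee_fin mulr_ge0// stable_kernel_ge0.
Qed.

(** The weight is a product, so along a line it is [bump] up to a constant. *)
Lemma slice_weight_axis_integral (phi : R -> R) s n (U : n.-tuple RT -> R) i x r :
  measurable_fun [set: R] phi -> (forall z, 0 <= phi z) ->
  measurable_fun [set: n.-tuple RT] U ->
  (\int[mu]_y ((weight r (tupd i x y))%:E * axis_integral phi s U i (tupd i x y)) =
   (\prod_(j < n | j != i) bump r (tnth x j))%:E *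
   \int[mu]_y \int[mu]_t (bump r y *
     phi (second_difference (fun y => U (tupd i x y)) y t) * stable_kernel s t)%:E)%E.
Proof.
move=> mphi phi0 mU; set c := \prod_(j < n | _) _.
have c0 : 0 <= c by apply: prodr_ge0 => j _; exact: bump_ge0.
have asd y t : axis_second_difference U i (tupd i x y) t =
    second_difference (fun y => U (tupd i x y)) y t.
  by rewrite /axis_second_difference /second_difference tnth_tupd eqxx !tupd_same.
have mupd := measurable_tupd i x.
have mline y : measurable_fun [set: RT]
    (fun t => phi (axis_second_difference U i (tupd i x y) t)).
  exact: (measurableT_comp mphi
    (measurableT_comp (measurable_axis_second_difference i mU)
      (@measurable_pair1 _ _ (n.-tuple RT) RT (tupd i x y)))).
have bE y : (\int[mu]_t (bump r y *
     phi (second_difference (fun y => U (tupd i x y)) y t) * stable_kernel s t)%:E =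
     (bump r y)%:E * axis_integral phi s U i (tupd i x y))%E.
  rewrite -ge0_integral_mulr//.
  - by apply: eq_integral => t _; rewrite asd mulrA.
  - apply: measurable_funM; last exact: measurable_stable_kernel.
    exact: mline.
  - by move=> t; rewrite mulr_ge0// stable_kernel_ge0.
  - exact: bump_ge0.
under [in RHS]eq_integral do rewrite bE.
rewrite -ge0_integralZl//.
- by apply: eq_integral => y _; rewrite weight_tupd EFinM muleA.
- apply: emeasurable_funM; first by apply/measurable_EFinP; exact: measurable_bump.
  exact: (measurableT_comp (measurable_axis_integral s i mphi phi0 mU) mupd).
- by move=> y _; rewrite mule_ge0 ?lee_fin ?bump_ge0// axis_integral_ge0.
Qed.

(** [line_inequality] on every line parallel to the [i]-th axis, integrated over
    the remaining coordinates. *)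
Lemma space_inequality s : 0 < s -> s < 1 -> exists2 K : R, 0 <= K &
  forall n (U : n.-tuple RT -> R) (r : R) (i : 'I_n),
  measurable_fun [set: n.-tuple RT] U -> (forall x, 0 <= U x) ->
  (forall x, continuous (fun y => U (tupd i x y))) -> 0 < r ->
  (\int[lebesgueN R n]_x ((weight r x)%:E * axis_integral posr s U i x) <=
   \int[lebesgueN R n]_x ((weight r x)%:E * axis_integral negr s U i x) +
   (K * r `^ (- (2 * s)))%:E * \int[lebesgueN R n]_x (weight r x * U x)%:E)%E.
Proof.
move=> s0 s1; have [K K0 line] := line_inequality s0 s1; exists K => //.
move=> n U r i mU U0 cU r0.
have c0 : 0 <= K * r `^ (- (2 * s)) by rewrite mulr_ge0// powR_ge0.
have mw := @measurable_weight n r.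
have w0 := @weight_ge0 n r.
have mp := measurable_axis_integral s i measurable_posr posr_ge0 mU.
have mn := measurable_axis_integral s i measurable_negr negr_ge0 mU.
have mwU : measurable_fun [set: n.-tuple RT] (fun x => weight r x * U x).
  exact: measurable_funM.
rewrite -ge0_integral_mulr//; last by move=> x; rewrite mulr_ge0.
rewrite -ge0_integralD//; first last.
- by apply/measurable_EFinP; exact: measurable_funM.
- by move=> x _; rewrite lee_fin !mulr_ge0 ?powR_ge0 ?bump_ge0 ?U0 ?w0.
- by apply: emeasurable_funM => //; exact/measurable_EFinP.
- by move=> x _; rewrite mule_ge0// ?lee_fin// axis_integral_ge0//; exact: negr_ge0.
apply: (lebesgueN_slice_le (i := i)).
- by apply: emeasurable_funM => //; exact/measurable_EFinP.
- apply: emeasurable_funD.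
    by apply: emeasurable_funM => //; exact/measurable_EFinP.
  by apply/measurable_EFinP; exact: measurable_funM.
- by move=> x; rewrite mule_ge0// ?lee_fin// axis_integral_ge0//; exact: posr_ge0.
- move=> x; rewrite adde_ge0//; last by rewrite lee_fin !mulr_ge0 ?powR_ge0 ?bump_ge0 ?U0 ?w0.
  by rewrite mule_ge0// ?lee_fin// axis_integral_ge0//; exact: negr_ge0.
move=> x; set f := fun y => U (tupd i x y).
have mwt : measurable_fun [set: R] (fun y => weight r (tupd i x y) : R).
  exact: (measurableT_comp mw (measurable_tupd i x)).
have mf : measurable_fun [set: R] f.
  exact: (measurableT_comp mU (measurable_tupd i x)).
have mnt : measurable_fun [set: R] (fun y => axis_integral negr s U i (tupd i x y)).
  exact: (measurableT_comp mn (measurable_tupd i x)).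
have mbf : measurable_fun [set: R] (fun y => bump r y * f y).
  by apply: measurable_funM => //; exact: measurable_bump.
have bf0 y : 0 <= bump r y * f y by rewrite mulr_ge0// ?bump_ge0 ?U0.
rewrite ge0_integralD//; first last.
- by apply/measurable_EFinP; apply: measurable_funM => //; exact: measurable_funM.
- by move=> y _; rewrite lee_fin !mulr_ge0 ?powR_ge0 ?bump_ge0 ?U0 ?w0.
- by apply: emeasurable_funM => //; exact/measurable_EFinP.
- by move=> y _; rewrite mule_ge0// ?lee_fin// axis_integral_ge0//; exact: negr_ge0.
rewrite (slice_weight_axis_integral _ _ _ _ measurable_posr posr_ge0 mU).
rewrite (slice_weight_axis_integral _ _ _ _ measurable_negr negr_ge0 mU).
set c := \prod_(j < n | _) _.
have cp0 : 0 <= c by apply: prodr_ge0 => j _; exact: bump_ge0.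
have -> : (\int[mu]_y (K * r `^ (- (2 * s)) *
      (weight r (tupd i x y) * U (tupd i x y)))%:E =
    c%:E * ((K * r `^ (- (2 * s)))%:E * \int[mu]_y (bump r y * f y)%:E))%E.
  rewrite muleA -EFinM -ge0_integral_mulr// ?mulr_ge0 ?powR_ge0//.
  by apply: eq_integral => y _; congr EFin; rewrite weight_tupd -/c /f; ring.
rewrite -ge0_muleDr; last 2 first.
- apply: integral_ge0 => y _; apply: integral_ge0 => t _.
  by rewrite lee_fin !mulr_ge0// ?bump_ge0 ?negr_ge0 ?stable_kernel_ge0.
- by rewrite mule_ge0 ?lee_fin//; apply: integral_ge0 => y _; rewrite lee_fin.
apply: lee_wpmul2l; first by rewrite lee_fin.
exact: line.
Qed.

End space_inequality.

(** * The operator in terms of one-sided axis integrals *)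

Section operator_on_tuples.
Context {R : realType} {N : nat}.
Local Notation RT := (measurableTypeR R).
Local Notation mu := (@lebesgue_measure R).
Implicit Types (u : 'rV[R]_N -> R) (x : N.-tuple RT).

Lemma row_of_tuple_tupd (i : 'I_N) x y :
  row_of_tuple (tupd i x y) = row_of_tuple x + (y - tnth x i) *: ebase i.
Proof.
apply/rowP => j; rewrite !mxE tnth_tupd eqxx/=.
by case: eqP => [->|_]; rewrite ?mulr1 ?mulr0 ?addr0// addrC subrK.
Qed.

Lemma axis_second_differenceE u (i : 'I_N) x t :
  axis_second_difference (u \o row_of_tuple) i x t =
  2 * u (row_of_tuple x) - u (row_of_tuple x + t *: ebase i) -
  u (row_of_tuple x - t *: ebase i).
Proof.
rewrite /axis_second_difference /second_difference /= !row_of_tuple_tupd.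
move: (ebase i) (row_of_tuple x) (tnth x i) => e X z.
have E a : z + a - z = a by ring.
by rewrite !E (subrr z) scale0r addr0 scaleNr.
Qed.

Lemma continuous_tupd u (i : 'I_N) x : continuous u ->
  continuous (fun y => (u \o row_of_tuple) (tupd i x y)).
Proof.
move=> cu y; rewrite /=.
rewrite (_ : (fun y => _) = u \o
    (fun y => row_of_tuple x + (y - tnth x i) *: ebase i)); last first.
  by apply/funext => z; rewrite /= row_of_tuple_tupd.
apply: continuous_comp; last exact: cu.
apply: cvgD; first exact: cvg_cst.
apply: cvgZl; apply: cvgB; [exact: cvg_id|exact: cvg_cst].
Qed.

(** Jumps shorter than 1 are controlled by the second derivatives, longer ones
    by the growth at infinity. *)
Lemma axis_integral_bounded s u (i : 'I_N) (rho : R) :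
  0 < s -> s < 1 -> Ck 2 u -> Ls s u -> 0 <= rho ->
  exists C : R, forall x (phi : R -> R), measurable_fun [set: R] phi ->
    (forall z, 0 <= phi z <= `|z|) -> (forall j, `|tnth x j| <= rho) ->
    (axis_integral phi s (u \o row_of_tuple) i x <= C%:E)%E.
Proof.
move=> s0 s1 C2u Lsu rho0.
have cu : continuous u by case: C2u.
have mU : measurable_fun [set: N.-tuple RT] (u \o row_of_tuple) by case: Lsu => [[]].
have [L1 L10 uL1] := C2_second_difference i rho C2u.
have [alpha /andP[alpha0 alphas] [L2 L20 uL2]] := Ls_growth cu Lsu rho0.
have [L3 L30 uL3] := continuous_slab_bounded rho cu.
pose gn t : R := \1_`]0, 1] `|t| * (t ^+ 2 * stable_kernel s t).
pose gf t : R := \1_`[1, +oo[ `|t| * (`|t| `^ alpha * stable_kernel s t).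
have k0 := stable_kernel_ge0 s.
have gn0 t : 0 <= gn t by do 2 apply: mulr_ge0 => //; exact: sqr_ge0.
have gf0 t : 0 <= gf t by do 2 apply: mulr_ge0 => //; exact: powR_ge0.
have mk := measurable_stable_kernel s.
have mgn : measurable_fun [set: R] gn.
  apply: measurable_funM; first exact: measurable_indic_norm.
  by apply: measurable_funM => //; exact: exprn_measurable.
have mgf : measurable_fun [set: R] gf.
  apply: measurable_funM; first exact: measurable_indic_norm.
  apply: measurable_funM => //.
  exact: (measurableT_comp (measurable_powR alpha) (@normr_measurable R setT)).
have hn := integral_stable_kernel_near0 s1 (@ltr01 R).
have hf := integral_stable_kernel_near_pinfty (@ltr01 R) alphas.
pose L4 := 2 * L3 + 2 * L2.
have L40 : 0 <= L4 by rewrite addr_ge0// mulr_ge0.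
exists (L1 * (1 `^ (2 - 2 * s) / (1 - s)) +
  L4 * (2 * 1 `^ (alpha - 2 * s) / (2 * s - alpha))).
move=> x phi mphi phi0 xr.
have rowr j : `|row_of_tuple x ord0 j| <= rho by rewrite mxE.
have sd_near t : `|t| <= 1 ->
    `|axis_second_difference (u \o row_of_tuple) i x t| <= L1 * t ^+ 2.
  by move=> t1; rewrite axis_second_differenceE; exact: uL1.
have sd_far t : 1 <= `|t| ->
    `|axis_second_difference (u \o row_of_tuple) i x t| <= L4 * `|t| `^ alpha.
  move=> t1; rewrite axis_second_differenceE.
  have h1 := uL2 i (row_of_tuple x) t rowr t1.
  have h2 := uL2 i (row_of_tuple x) (- t) rowr; rewrite normrN scaleNr in h2.
  have {}h2 := h2 t1.
  have h3 := uL3 _ rowr.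
  have ta1 : 1 <= `|t| `^ alpha by rewrite -(powRr0 `|t|) ler_powR.
  apply: le_trans (ler_normB _ _) _.
  apply: le_trans (lerD (ler_normB _ _) (lexx _)) _.
  rewrite normrM (gtr0_norm (@ltr0n R 2))//.
  have : L3 <= L3 * `|t| `^ alpha by rewrite ler_peMr.
  rewrite /L4; lra.
clearbody L4.
apply: (@le_trans _ _ (\int[mu]_t (L1 * gn t + L4 * gf t)%:E)%E); last first.
  rewrite ge0_integral_addr//; first last.
  - by move=> t; rewrite mulr_ge0.
  - by move=> t; rewrite mulr_ge0.
  - exact: measurable_funM.
  - exact: measurable_funM.
  rewrite !ge0_integral_mulr// EFinD.
  by apply: leeD; rewrite EFinM; apply: lee_wpmul2l.
apply: ge0_le_integralr.
- apply: measurable_funM => //.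
  apply: (measurableT_comp mphi).
  exact: (measurableT_comp (measurable_axis_second_difference i mU)
      (@measurable_pair1 _ _ (N.-tuple RT) RT x)).
- by apply: measurable_funD; apply: measurable_funM.
- by move=> t; rewrite mulr_ge0//; case/andP: (phi0 (axis_second_difference (u \o row_of_tuple) i x t)).
move=> t.
have /andP[p0 p1] := phi0 (axis_second_difference (u \o row_of_tuple) i x t).
have [t1|t1] := leP `|t| 1.
  apply: (@le_trans _ _ (L1 * gn t)); last by rewrite lerDl mulr_ge0.
  have h := le_trans p1 (sd_near _ t1).
  rewrite /gn indicE mem_setE in_itv/= t1 andbT normr_gt0.
  have [t0|t0] := eqVneq t 0; last by rewrite mul1r mulrA ler_wpM2r.
  have -> : phi (axis_second_difference (u \o row_of_tuple) i x t) = 0.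
    apply/eqP; rewrite eq_le p0 andbT; apply: le_trans h _.
    by rewrite t0 expr0n mulr0.
  by rewrite !mul0r mulr0.
apply: (@le_trans _ _ (L4 * gf t)); last by rewrite lerDr mulr_ge0.
have h := le_trans p1 (sd_far _ (ltW t1)).
by rewrite /gf indicE mem_setE in_itv/= (ltW t1) mul1r mulrA ler_wpM2r.
Qed.

(** Finiteness of both parts matters: otherwise the real-valued integral in
    [Ii] would take a default value unrelated to them. *)
Lemma IiE s u (i : 'I_N) x :
  (axis_integral (@posr R) s (u \o row_of_tuple) i x < +oo)%E ->
  (axis_integral (@negr R) s (u \o row_of_tuple) i x < +oo)%E ->
  - Ii s i u (row_of_tuple x) = Cs s / 2 *
    (fine (axis_integral (@posr R) s (u \o row_of_tuple) i x) -
     fine (axis_integral (@negr R) s (u \o row_of_tuple) i x)).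
Proof.
move=> Pfin Nfin; rewrite /Ii -mulrN; congr (_ * _).
pose D := axis_second_difference (u \o row_of_tuple) i x.
have k0 := stable_kernel_ge0 s.
rewrite /Rintegral integralE.
rewrite [X in fine (X - _)%E](_ : _ = axis_integral (@negr R) s (u \o row_of_tuple) i x); last first.
  apply: eq_integral => t _; rewrite funeposE -EFin_max; congr EFin.
  rewrite -/D (_ : _ / _ = - D t * stable_kernel s t); last first.
    by rewrite /D axis_second_differenceE /stable_kernel; congr (_ * _); ring.
  by rewrite /negr maxr_pMl// mul0r.
rewrite [X in fine (_ - X)%E](_ : _ = axis_integral (@posr R) s (u \o row_of_tuple) i x); last first.
  apply: eq_integral => t _; rewrite funenegE -EFinN -EFin_max; congr EFin.
  rewrite -/D (_ : - (_ / _) = D t * stable_kernel s t); last first.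
    by rewrite /D axis_second_differenceE /stable_kernel -mulNr; congr (_ * _); ring.
  by rewrite /posr maxr_pMl// mul0r.
rewrite fineB ?opprB// ge0_fin_numE// axis_integral_ge0//;
  [exact: negr_ge0|exact: posr_ge0].
Qed.

End operator_on_tuples.

(** * The energy inequality *)

Section energy.
Context {R : realType}.
Local Notation RT := (measurableTypeR R).

Definition cube0 (n : nat) (r : R) : set (n.-tuple RT) := cube [tuple 0 | i < n] r.

Arguments cube0 n r _ : clear implicits.

Lemma cube0E n (r : R) (x : n.-tuple RT) : cube0 n r x <-> forall i, `|tnth x i| < r.
Proof.
split=> h i; have := h i; first by rewrite tnth_mktuple sub0r normrN.
by rewrite tnth_mktuple sub0r normrN.
Qed.

Lemma weight_le_cube0 n (r : R) (x : n.-tuple RT) : 0 < r ->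
  weight r x <= \1_(cube0 n r) x.
Proof.
move=> r0; rewrite indicE; have [/set_mem xr|xr] := boolP (x \in cube0 n r).
  apply: prodr_ile1 => i _; by rewrite bump_ge0 bump_le1.
have [i xi] : exists i, r <= `|tnth x i|.
  apply: contrapT => H; move/negP : xr; apply; apply/mem_set/cube0E => i.
  by rewrite ltNge; apply/negP => ri; apply: H; exists i.
by rewrite /weight (bigD1 i)//= bump0// mul0r.
Qed.

Lemma weight_outside n (r : R) (x : n.-tuple RT) : 0 < r -> ~ cube0 n r x ->
  weight r x = 0.
Proof.
move=> r0 xr; apply/le_anti; rewrite weight_ge0 andbT.
by apply: le_trans (weight_le_cube0 _ r0) _; rewrite indicE memNset.
Qed.

Lemma integral_weight_lty n (r : R) (g : n.-tuple RT -> R) (C : R) : 0 < r ->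
  measurable_fun [set: n.-tuple RT] g -> (forall x, 0 <= g x) ->
  (forall x, (forall i, `|tnth x i| <= r) -> g x <= C) ->
  (\int[lebesgueN R n]_x (weight r x * g x)%:E < +oo)%E.
Proof.
move=> r0 mg g0 gC.
have C0 : 0 <= C.
  apply: le_trans (gC [tuple 0 | i < n] _) => // i.
  by rewrite tnth_mktuple normr0 ltW.
have mc : measurable (cube0 n r) by exact: measurable_cube.
apply: (@le_lt_trans _ _ (\int[lebesgueN R n]_x (C * \1_(cube0 n r) x)%:E)%E).
  apply: ge0_le_integralr.
  - by apply: measurable_funM => //; exact: measurable_weight.
  - by apply: measurable_funM => //; exact: measurable_indic.
  - by move=> x; rewrite mulr_ge0// weight_ge0.
  move=> x; have [xr|xr] := pselect (cube0 n r x); last first.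
    by rewrite weight_outside// mul0r mulr_ge0.
  rewrite mulrC ler_pM ?weight_ge0 ?weight_le_cube0//.
  by apply: gC => i; apply/ltW; move/cube0E : xr.
rewrite ge0_integral_mulr//.
rewrite integral_indic//= setIT lebesgueN_cube ?(ltW r0)//.
by rewrite -EFinM ltry.
Qed.

(** Summing [space_inequality] over the axes leaves the same finite sum of
    integrals of negative parts on both sides, which cancels. *)
Lemma energy_inequality n (U : n.-tuple RT -> R) (s p c : R) :
  0 < s -> s < 1 -> 0 <= c ->
  measurable_fun [set: n.-tuple RT] U -> (forall x, 0 <= U x) ->
  (forall i x, continuous (fun y => U (tupd i x y))) ->
  (forall i (rho : R), 0 <= rho -> exists C : R, forall x,
     (forall j, `|tnth x j| <= rho) ->
     (axis_integral (@posr R) s U i x <= C%:E)%E /\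
     (axis_integral (@negr R) s U i x <= C%:E)%E) ->
  (forall x, U x `^ p <= \sum_(i < n) c * (fine (axis_integral (@posr R) s U i x) -
                                          fine (axis_integral (@negr R) s U i x))) ->
  exists2 kappa : R, 0 <= kappa & forall r : R, 0 < r ->
    (\int[lebesgueN R n]_x (weight r x * U x `^ p)%:E <=
     (kappa * r `^ (- (2 * s)))%:E * \int[lebesgueN R n]_x (weight r x * U x)%:E)%E.
Proof.
move=> s0 s1 c0 mU U0 cU bU hU.
have [K K0 spaceK] := space_inequality s0 s1.
exists (n%:R * c * K); first by rewrite !mulr_ge0.
move=> r r0.
pose P i x := fine (axis_integral (@posr R) s U i x).
pose Q i x := fine (axis_integral (@negr R) s U i x).
have fin_of (phi : R -> R) i x (C : R) : (forall z, 0 <= phi z) ->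
    (axis_integral phi s U i x <= C%:E)%E -> axis_integral phi s U i x \is a fin_num.
  move=> phi0 hC; rewrite ge0_fin_numE ?axis_integral_ge0//.
  by apply: le_lt_trans hC _; rewrite ltry.
have xbound (x : n.-tuple RT) : exists2 rho : R, 0 <= rho & forall j, `|tnth x j| <= rho.
  exists (\sum_(j < n) `|tnth x j|); first exact: sumr_ge0.
  by move=> j; rewrite (bigD1 j)//= lerDl sumr_ge0.
have PE i x : (axis_integral (@posr R) s U i x = (P i x)%:E)%E.
  have [rho rho0 xrho] := xbound x; have [C /(_ _ xrho)[hP _]] := bU i _ rho0.
  by rewrite fineK//; apply: fin_of hP; exact: posr_ge0.
have QE i x : (axis_integral (@negr R) s U i x = (Q i x)%:E)%E.
  have [rho rho0 xrho] := xbound x; have [C /(_ _ xrho)[_ hQ]] := bU i _ rho0.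
  by rewrite fineK//; apply: fin_of hQ; exact: negr_ge0.
have P0 i x : 0 <= P i x.
  by apply/fine_ge0/axis_integral_ge0; exact: posr_ge0.
have Q0 i x : 0 <= Q i x.
  by apply/fine_ge0/axis_integral_ge0; exact: negr_ge0.
have mP i : measurable_fun [set: n.-tuple RT] (P i).
  apply: (measurableT_comp (@fine_measurable R setT measurableT)).
  exact: (measurable_axis_integral s i (@measurable_posr R) (@posr_ge0 R) mU).
have mQ i : measurable_fun [set: n.-tuple RT] (Q i).
  apply: (measurableT_comp (@fine_measurable R setT measurableT)).
  exact: (measurable_axis_integral s i (@measurable_negr R) (@negr_ge0 R) mU).
have mw := @measurable_weight R n r.
have w0 := @weight_ge0 R n r.
set K' := K * r `^ (- (2 * s)).
have K'0 : 0 <= K' by rewrite mulr_ge0// powR_ge0.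
set J := (\int[lebesgueN R n]_x (weight r x * U x)%:E)%E.
have J0 : (0 <= J)%E by apply: integral_ge0 => x _; rewrite lee_fin mulr_ge0.
have space i : (\int[lebesgueN R n]_x (weight r x * P i x)%:E <=
    \int[lebesgueN R n]_x (weight r x * Q i x)%:E + K'%:E * J)%E.
  have := spaceK n U r i mU U0 (cU i) r0.
  under eq_integral do rewrite PE -EFinM.
  by under [X in (_ <= X + _)%E -> _]eq_integral do rewrite QE -EFinM.
have mwP i : measurable_fun [set: n.-tuple RT] (fun x => c * (weight r x * P i x)).
  by apply: measurable_funM => //; exact: measurable_funM.
have mwQ i : measurable_fun [set: n.-tuple RT] (fun x => c * (weight r x * Q i x)).
  by apply: measurable_funM => //; exact: measurable_funM.
have mwU : measurable_fun [set: n.-tuple RT] (fun x => weight r x * U x `^ p).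
  by apply: measurable_funM => //; exact: (measurableT_comp (measurable_powR p)).
have wP0 i x : 0 <= c * (weight r x * P i x) by rewrite !mulr_ge0.
have wQ0 i x : 0 <= c * (weight r x * Q i x) by rewrite !mulr_ge0.
pose X : \bar R := (\sum_(i < n) c%:E * \int[lebesgueN R n]_x (weight r x * Q i x)%:E)%E.
have bound : (\int[lebesgueN R n]_x (weight r x * U x `^ p)%:E + X <=
    X + (n%:R * c * K * r `^ (- (2 * s)))%:E * J)%E.
  have -> : X = (\int[lebesgueN R n]_x (\sum_i c * (weight r x * Q i x))%:E)%E.
    rewrite ge0_integral_sumr//; apply: eq_bigr => i _.
    by rewrite ge0_integral_mulr//; [exact: measurable_funM|move=> x; rewrite mulr_ge0].
  rewrite -ge0_integral_addr//; first last.
  - by move=> x; exact: sumr_ge0.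
  - by move=> x; rewrite mulr_ge0// powR_ge0.
  - exact: measurable_sum.
  apply: (@le_trans _ _ (\int[lebesgueN R n]_x (\sum_i c * (weight r x * P i x))%:E)%E).
    apply: ge0_le_integralr.
    - by apply: measurable_funD => //; exact: measurable_sum.
    - exact: measurable_sum.
    - by move=> x; rewrite addr_ge0 ?mulr_ge0 ?powR_ge0// sumr_ge0.
    move=> x; have := ler_wpM2l (w0 x) (hU x).
    rewrite -lerBrDr -sumrB; congr (_ <= _); rewrite mulr_sumr.
    by apply: eq_bigr => i _; rewrite /P /Q; ring.
  rewrite !ge0_integral_sumr//.
  apply: (@le_trans _ _ (\sum_(i < n) (\int[lebesgueN R n]_x (c * (weight r x * Q i x))%:E
      + (c * K')%:E * J))%E).
    apply: lee_sum => i _.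
    rewrite !ge0_integral_mulr//; [|exact: measurable_funM|by move=> x; rewrite mulr_ge0
      |exact: measurable_funM|by move=> x; rewrite mulr_ge0].
    rewrite EFinM -muleA -ge0_muleDr; [|by apply: integral_ge0 => x _; rewrite lee_fin mulr_ge0
      |by rewrite mule_ge0// lee_fin].
    by apply: lee_wpmul2l; rewrite ?lee_fin.
  rewrite big_split/=; apply: leeD => //.
  rewrite -ge0_sume_distrl; last by move=> i _; rewrite lee_fin mulr_ge0.
  rewrite sumEFin sumr_const card_ord.
  by rewrite -[c * K' *+ n]mulr_natl /K' !mulrA.
have Xfin : X \is a fin_num.
  apply/sum_fin_numP => i _ _.
  rewrite fin_numM// ge0_fin_numE; last first.
    by apply: integral_ge0 => x _; rewrite lee_fin mulr_ge0.
  have [C hC] := bU i r (ltW r0).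
  apply: (@integral_weight_lty n r _ C) => // x xr.
  by have [_] := hC x xr; rewrite QE lee_fin.
by rewrite -(leeD2rE _ _ Xfin); apply: le_trans bound _; rewrite addeC.
Qed.

End energy.
Arguments cube0 {R} n r _.

(** * Absorbing the right-hand side *)

Section absorption.
Context {R : realType}.
Local Notation RT := (measurableTypeR R).

(** Either [a <= lam * z `^ (p - 1)], and the first term is enough, or [z] is
    below the threshold [(a / lam) `^ (p - 1)^-1], and the second one is. *)
Lemma young_split (p lam a z : R) : 1 < p -> 0 < lam -> 0 <= a -> 0 <= z ->
  a * z <= lam * z `^ p + a * (a / lam) `^ (p - 1)^-1.
Proof.
move=> p1 lam0 a0 z0.
have p10 : 0 < p - 1 by rewrite subr_gt0.
have [h|h] := leP a (lam * z `^ (p - 1)).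
  apply: (@le_trans _ _ (lam * z `^ p)); last by rewrite lerDl mulr_ge0// powR_ge0.
  rewrite -(mulr_powRB1 z0 (lt_trans ltr01 p1)) mulrCA mulrC.
  exact: ler_wpM2l.
apply: (@le_trans _ _ (a * (a / lam) `^ (p - 1)^-1)); last first.
  by rewrite lerDr mulr_ge0 ?powR_ge0 ?(ltW lam0).
rewrite ler_wpM2l// -[leLHS](powRr1 z0) -[X in _ `^ X](mulfV (lt0r_neq0 p10)) powRrM.
apply: ge0_ler_powR; rewrite ?nnegrE ?powR_ge0 ?invr_ge0 ?divr_ge0 ?(ltW p10) ?(ltW lam0)//.
by rewrite ler_pdivlMr// mulrC ltW.
Qed.

Lemma powRN_small (A eps b : R) : 0 <= A -> 0 < eps -> 0 < b ->
  exists2 l0 : R, 0 < l0 & forall l, l0 <= l -> A * l `^ (- b) <= eps.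
Proof.
move=> A0 e0 b0; pose c := (A + 1) / eps.
have c0 : 0 < c by rewrite divr_gt0// ltr_wpDl.
exists (c `^ b^-1); first exact: powR_gt0.
move=> l hl; have l0 : 0 < l by apply: lt_le_trans hl; exact: powR_gt0.
rewrite powRN ler_pdivrMr ?powR_gt0// mulrC -ler_pdivrMr//.
apply: (@le_trans _ _ c); first by rewrite ler_pM2r ?invr_gt0// lerDl.
rewrite -[leLHS](powRr1 (ltW c0)) -[X in _ `^ X](mulVf (lt0r_neq0 b0)) powRrM.
by apply: ge0_ler_powR; rewrite ?nnegrE ?powR_ge0 ?(ltW b0) ?(ltW l0).
Qed.

(** On the cube of half-width [m <= r / 2] each factor is at least
    1 - 1/4. *)
Lemma weight_ge n (m r : R) (x : n.-tuple RT) : 0 < r -> 2 * m <= r ->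
  cube0 n m x -> (3 / 4) ^+ n <= weight r x.
Proof.
move=> r0 mr /cube0E xm.
rewrite -[n in X in X <= _](card_ord n) -prodr_const; apply: ler_prod => i _.
apply/andP; split; first by rewrite divr_ge0.
rewrite le_max; apply/orP; left.
have : `|tnth x i / r| <= 2^-1.
  rewrite normrM normfV (gtr0_norm r0) ler_pdivrMr//.
  by apply: le_trans (ltW (xm i)) _; lra.
rewrite ler_norml => /andP[h1 h2]; nra.
Qed.

Lemma integral_cube0_le n (f : n.-tuple RT -> R) (C : R) :
  measurable_fun [set: n.-tuple RT] f -> (forall x, 0 <= f x) ->
  (forall m : nat, \int[lebesgueN R n]_x (\1_(cube0 n m%:R) x * f x)%:E <= C%:E)%E ->
  (\int[lebesgueN R n]_x (f x)%:E <= C%:E)%E.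
Proof.
move=> mf f0 fC.
rewrite (_ : [set: n.-tuple RT] = \bigcup_m cube0 n m%:R); last first.
  apply/seteqP; split=> // x _; exists (Num.truncn (\sum_(j < n) `|tnth x j|)).+1 => //.
  apply/cube0E => i; apply: le_lt_trans (truncnS_gt _).
  by rewrite (bigD1 i)//= lerDl sumr_ge0.
apply: integral_bigcup_le => //.
- apply/nondecreasing_seqP => m; rewrite subsetEset => x /cube0E h; apply/cube0E => i.
  by apply: lt_le_trans (h i) _; rewrite ler_nat.
- by move=> m; exact: measurable_cube.
- exact/measurable_EFinP.
- move=> m; apply: le_trans (fC m); rewrite integral_mkcond.
  rewrite le_eqVlt; apply/orP; left; apply/eqP; apply: eq_integral => x _.
  by rewrite patchE indicE; case: (x \in _); rewrite ?mul1r ?mul0r.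
Qed.

Lemma integral_le_of_weights n (h : n.-tuple RT -> R) (B r0 : R) :
  measurable_fun [set: n.-tuple RT] h -> (forall x, 0 <= h x) ->
  (forall r : R, (0 < r)%R -> (r0 <= r)%R ->
    \int[lebesgueN R n]_x (weight r x * h x)%:E <= B%:E)%E ->
  (\int[lebesgueN R n]_x (h x)%:E <= ((4 / 3) ^+ n * B)%:E)%E.
Proof.
move=> mh h0 hB; apply: integral_cube0_le => // m.
(* [weight_ge] needs [2 * m <= r]; the extra 1 makes [r] positive at [m = 0] *)
pose r := Num.max (2 * m%:R + 1) r0.
have rpos : 0 < r by rewrite lt_max ltr_wpDl// mulr_ge0.
have mr : 2 * m%:R <= r by rewrite le_max lerDl ler01.
have r0r : r0 <= r by rewrite le_max lexx orbT.
have mc : measurable (cube0 n m%:R : set (n.-tuple RT)) by exact: measurable_cube.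
have c0 : 0 <= (4 / 3 : R) ^+ n by rewrite exprn_ge0// divr_ge0.
apply: (@le_trans _ _ (\int[lebesgueN R n]_x ((4 / 3) ^+ n * (weight r x * h x))%:E)%E).
  apply: ge0_le_integralr.
  - by apply: measurable_funM => //; exact: measurable_indic.
  - apply: measurable_funM => //; apply: measurable_funM => //.
    exact: measurable_weight.
  - by move=> x; rewrite mulr_ge0.
  move=> x; rewrite mulrA ler_wpM2r// indicE.
  case: (boolP (x \in _)) => [/set_mem xm|_]; last by rewrite mulr_ge0// weight_ge0.
  apply: le_trans (ler_wpM2l c0 (weight_ge rpos mr xm)).
  rewrite -exprMn (_ : 4 / 3 * (3 / 4) = 1) ?expr1n//; lra.
rewrite ge0_integral_mulr//; last 2 first.
- by apply: measurable_funM => //; exact: measurable_weight.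
- by move=> x; rewrite mulr_ge0// weight_ge0.
by rewrite EFinM; apply: lee_wpmul2l; [rewrite lee_fin|exact: hB].
Qed.

(** Young's inequality is used only outside [E]; its constant term is integrated
    over the cube of side [2 r] and scales like [r] to the power
    n - 2s p/(p-1), nonpositive by the hypothesis on [p]. The choice of [E]
    distinguishes the two absorptions: empty for finiteness, a large cube for
    vanishing. *)
Lemma split_estimate n (U : n.-tuple RT -> R) (s p kappa lam r : R)
    (E : set (n.-tuple RT)) :
  0 < s -> 1 < p -> 0 <= kappa -> 0 < lam -> 1 <= r -> measurable E ->
  n%:R * (p - 1) <= 2 * s * p ->
  measurable_fun [set: n.-tuple RT] U -> (forall x, 0 <= U x) ->
  (\int[lebesgueN R n]_x (weight r x * U x `^ p)%:E <=
    (kappa * r `^ (- (2 * s)))%:E * \int[lebesgueN R n]_x (weight r x * U x)%:E)%E ->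
  (\int[lebesgueN R n]_x (weight r x * U x `^ p)%:E <=
    (kappa * r `^ (- (2 * s)))%:E * \int[lebesgueN R n]_x (\1_E x * U x)%:E +
    lam%:E * \int[lebesgueN R n]_x (\1_(~` E) x * (weight r x * U x `^ p))%:E +
    (kappa * (kappa / lam) `^ (p - 1)^-1 * 2 ^+ n)%:E)%E.
Proof.
move=> s0 p1 kappa0 lam0 r1 mE crit mU U0.
have r0 : 0 < r by apply: lt_le_trans r1.
have p10 : 0 < p - 1 by rewrite subr_gt0.
set a := kappa * r `^ (- (2 * s)).
have a0 : 0 <= a by rewrite mulr_ge0// powR_ge0.
have mw := @measurable_weight R n r.
have w0 := @weight_ge0 R n r.
have mUp : measurable_fun [set: n.-tuple RT] (fun x => U x `^ p).
  exact: (measurableT_comp (measurable_powR p)).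
have Up0 x : 0 <= U x `^ p by exact: powR_ge0.
have mc : measurable (cube0 n r : set (n.-tuple RT)) by exact: measurable_cube.
have m1 : measurable_fun [set: n.-tuple RT] (\1_E : _ -> R) by exact: measurable_indic.
have m2 : measurable_fun [set: n.-tuple RT] (\1_(~` E) : _ -> R).
  by apply: measurable_indic; exact: measurableC.
have m3 : measurable_fun [set: n.-tuple RT] (\1_(cube0 n r) : _ -> R).
  exact: measurable_indic.
set b := a * (a / lam) `^ (p - 1)^-1.
have b0 : 0 <= b by rewrite mulr_ge0// powR_ge0.
pose g1 x := \1_E x * U x.
pose g2 x := \1_(~` E) x * (weight r x * U x `^ p).
have mg1 : measurable_fun [set: n.-tuple RT] g1 by exact: measurable_funM.
have mg2 : measurable_fun [set: n.-tuple RT] g2.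
  by apply: measurable_funM => //; exact: measurable_funM.
have g10 x : 0 <= g1 x by rewrite mulr_ge0.
have g20 x : 0 <= g2 x by rewrite !mulr_ge0.
move=> h; apply: (le_trans h).
rewrite -ge0_integral_mulr//; last 2 first.
- exact: measurable_funM.
- by move=> x; rewrite mulr_ge0.
apply: (@le_trans _ _ (\int[lebesgueN R n]_x
    (a * g1 x + lam * g2 x + b * \1_(cube0 n r) x)%:E)%E).
  apply: ge0_le_integralr.
  - by apply: measurable_funM => //; exact: measurable_funM.
  - apply: measurable_funD; last exact: measurable_funM.
    by apply: measurable_funD; exact: measurable_funM.
  - by move=> x; rewrite !mulr_ge0// powR_ge0.
  move=> x; have wle := weight_le_cube0 x r0.
  have wle1 : weight r x <= 1.
    by apply: le_trans wle _; rewrite indicE lern1 leq_b1.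
  have [xE|xE] := pselect (E x).
    apply: (@le_trans _ _ (a * g1 x)).
      rewrite /g1 indicE mem_set// mul1r ler_wpM2l//.
      by rewrite -[leRHS]mul1r ler_wpM2r.
    by rewrite -addrA lerDl addr_ge0// mulr_ge0// ltW.
  rewrite /g1 /g2 !indicE memNset// mem_set// mul0r mulr0 add0r mul1r.
  apply: (@le_trans _ _ (weight r x * (lam * U x `^ p + b))).
    by rewrite mulrCA ler_wpM2l//; exact: young_split.
  rewrite mulrDr mulrCA lerD2l mulrC ler_wpM2l//.
rewrite ge0_integral_addr//; first last.
- by move=> x; rewrite mulr_ge0.
- by move=> x; rewrite addr_ge0// mulr_ge0// ltW.
- exact: measurable_funM.
- by apply: measurable_funD; exact: measurable_funM.
rewrite ge0_integral_addr//; first last.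
- by move=> x; rewrite mulr_ge0// ltW.
- by move=> x; rewrite mulr_ge0.
- exact: measurable_funM.
- exact: measurable_funM.
rewrite !ge0_integral_mulr ?(ltW lam0)//; apply: leeD => //.
rewrite integral_indic//= setIT lebesgueN_cube ?(ltW r0)//.
rewrite -EFinM lee_fin -[r *+ 2]mulr_natl exprMn.
set q := (p - 1)^-1 in b0 *.
have q0 : 0 < q by rewrite invr_gt0.
have -> : b = kappa * (kappa / lam) `^ q * (r `^ (- (2 * s)) * r `^ (- (2 * s) * q)).
  rewrite [r `^ (_ * q)]powRrM /b -/q [a / lam](mulrAC kappa) [in LHS]powRM.
  - by rewrite /a; ring.
  - by rewrite divr_ge0 ?(ltW lam0).
  - exact: powR_ge0.
rewrite -(powR_mulrn n (ltW r0)).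
rewrite [leLHS](_ : _ = kappa * (kappa / lam) `^ q * 2 ^+ n *
    (r `^ (- (2 * s)) * r `^ (- (2 * s) * q) * r `^ n%:R)); last by ring.
rewrite -powRD; last by rewrite (gt_eqF r0) implybT.
rewrite -powRD; last by rewrite (gt_eqF r0) implybT.
rewrite ler_piMr//; first by rewrite !mulr_ge0// ?powR_ge0// exprn_ge0.
rewrite -[leRHS](powRr0 r) ler_powR//.
have : n%:R <= 2 * s * p * q by rewrite ler_pdivlMr.
have pq : p * q = 1 + q by rewrite /q; field; rewrite gt_eqF.
rewrite -mulrA pq; lra.
Qed.

End absorption.

Section vanishing.
Context {R : realType}.
Local Notation RT := (measurableTypeR R).

Lemma integral_powR_eq0 n (U : n.-tuple RT -> R) (s p kappa : R) :
  0 < s -> 1 < p -> 0 <= kappa -> n%:R * (p - 1) <= 2 * s * p ->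
  measurable_fun [set: n.-tuple RT] U -> (forall x, 0 <= U x) ->
  (forall rho : R, 0 <= rho -> exists C : R, forall x,
     (forall j, `|tnth x j| <= rho) -> U x <= C) ->
  (forall r : R, 0 < r ->
    (\int[lebesgueN R n]_x (weight r x * U x `^ p)%:E <=
     (kappa * r `^ (- (2 * s)))%:E * \int[lebesgueN R n]_x (weight r x * U x)%:E)%E) ->
  (\int[lebesgueN R n]_x (U x `^ p)%:E = 0)%E.
Proof.
move=> s0 p1 kappa0 crit mU U0 bU energy.
have p0 : 0 < p by apply: lt_trans p1.
have p10 : 0 < p - 1 by rewrite subr_gt0.
have mw := @measurable_weight R n.
have w0 := @weight_ge0 R n.
have mUp : measurable_fun [set: n.-tuple RT] (fun x => U x `^ p).
  exact: (measurableT_comp (measurable_powR p)).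
have Up0 x : 0 <= U x `^ p by exact: powR_ge0.
have mc (m : R) : measurable (cube0 n m : set (n.-tuple RT)) by exact: measurable_cube.
set S := (\int[lebesgueN R n]_x (U x `^ p)%:E)%E.
have S0 : (0 <= S)%E by apply: integral_ge0 => x _; rewrite lee_fin.
(* With [E] empty and [lam = 1/2] the weighted integral, finite by local
   boundedness, is at most half of itself plus a constant. *)
have Sfin : S \is a fin_num.
  rewrite ge0_fin_numE//; pose G := kappa * (kappa / 2^-1) `^ (p - 1)^-1 * 2 ^+ n.
  have half r : 0 < r -> 1 <= r ->
      (\int[lebesgueN R n]_x (weight r x * U x `^ p)%:E <= (2 * G)%:E)%E.
    move=> r0 r1; set Y := (\int[_]_x _)%E.
    have Yfin : (Y < +oo)%E.
      have [C hC] := bU r (ltW r0).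
      apply: (@integral_weight_lty _ n r _ (C `^ p)) => // x xr.
      by apply: ge0_ler_powR; rewrite ?nnegrE ?(ltW p0)//; [exact: le_trans (hC x xr)|exact: hC].
    have half0 : 0 < (2 : R)^-1 by rewrite invr_gt0.
    have := split_estimate s0 p1 kappa0 half0 r1 (@measurable0 _ (n.-tuple RT)) crit mU U0 (energy r r0).
    rewrite [X in (_ * X + _ + _)%E](_ : _ = 0%E); last first.
      by rewrite integral0_eq// => x _; rewrite indicE in_set0 mul0r.
    rewrite [X in (_ + _ * X + _)%E](_ : _ = Y); last first.
      by apply: eq_integral => x _; rewrite setC0 indicE in_setT mul1r.
    rewrite mule0 add0e.
    rewrite -/Y -/G.
    have Y0 : (0 <= Y)%E by apply: integral_ge0 => x _; rewrite lee_fin mulr_ge0.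
    rewrite -(fineK (_ : Y \is a fin_num)) ?ge0_fin_numE//.
    by rewrite -EFinM -EFinD !lee_fin => hY; lra.
  apply: (@le_lt_trans _ _ ((4 / 3) ^+ n * (2 * G))%:E); last by rewrite ltry.
  by apply: (@integral_le_of_weights R n _ _ 1).
(* If no tail were below [eta], exhaustion by cubes would give
   [S <= S - eta]. *)
have tail (eta : R) : 0 < eta -> exists m : nat,
    (\int[lebesgueN R n]_x (\1_(~` cube0 n m%:R) x * U x `^ p)%:E <= eta%:E)%E.
  move=> eta0; apply: contrapT => H.
  have mI (m : nat) : measurable_fun [set: n.-tuple RT] (fun x => \1_(cube0 n m%:R) x * U x `^ p).
    by apply: measurable_funM => //; exact: measurable_indic.
  have mJ (m : nat) : measurable_fun [set: n.-tuple RT] (fun x => \1_(~` cube0 n m%:R) x * U x `^ p).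
    by apply: measurable_funM => //; apply: measurable_indic; exact: measurableC.
  have : (S <= (fine S - eta)%:E)%E.
    apply: integral_cube0_le => // m.
    have SE : (S = \int[lebesgueN R n]_x (\1_(cube0 n m%:R) x * U x `^ p)%:E +
        \int[lebesgueN R n]_x (\1_(~` cube0 n m%:R) x * U x `^ p)%:E)%E.
      rewrite -ge0_integral_addr//; last 2 first.
      - by move=> x; rewrite mulr_ge0.
      - by move=> x; rewrite mulr_ge0.
      apply: eq_integral => x _; congr EFin; rewrite !indicE in_setC.
      by case: (x \in _); rewrite ?mul1r ?mul0r ?addr0 ?add0r.
    have : (eta%:E <= \int[lebesgueN R n]_x (\1_(~` cube0 n m%:R) x * U x `^ p)%:E)%E.
      by rewrite leNgt; apply/negP => hm; apply: H; exists m; exact: ltW.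
    have eta_fin : eta%:E \is a fin_num by [].
    move=> h; rewrite -(leeD2rE _ _ eta_fin) -EFinD subrK fineK// SE.
    exact: leeD2l.
  by rewrite -[X in (X <= _)%E](fineK Sfin) lee_fin lerBrDr gerDl leNgt eta0.
(* The three terms are made small in this order: the constant by [lam], the
   tail by the cube (which depends on [lam]), the cube by [r]. *)
have small (eps : R) : 0 < eps -> exists r0 : R, forall r, 0 < r -> r0 <= r ->
    (\int[lebesgueN R n]_x (weight r x * U x `^ p)%:E <= (3 * eps)%:E)%E.
  move=> eps0.
  have q0 : 0 < (p - 1)^-1 by rewrite invr_gt0.
  have A0 : 0 <= kappa * kappa `^ (p - 1)^-1 * 2 ^+ n.
    by rewrite !mulr_ge0 ?powR_ge0 ?exprn_ge0.
  have [lam lam0 /(_ _ (lexx lam)) hlam] := powRN_small A0 eps0 q0.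
  have [m hm] := tail (eps / lam) (divr_gt0 eps0 lam0).
  have [C hC] := bU m%:R (ler0n _ _).
  set B := (\int[lebesgueN R n]_x (\1_(cube0 n m%:R) x * U x)%:E)%E.
  have B0 : (0 <= B)%E by apply: integral_ge0 => x _; rewrite lee_fin mulr_ge0.
  have Bfin : B \is a fin_num.
    have mcm : measurable_fun [set: n.-tuple RT] (\1_(cube0 n m%:R) : _ -> R).
      exact: measurable_indic.
    rewrite ge0_fin_numE//.
    apply: (@le_lt_trans _ _ (\int[lebesgueN R n]_x (`|C| * \1_(cube0 n m%:R) x)%:E)%E).
      apply: ge0_le_integralr => //.
      - exact: measurable_funM.
      - exact: measurable_funM.
      - by move=> x; rewrite mulr_ge0.
      move=> x; rewrite mulrC indicE; case: (boolP (x \in _)) => [/set_mem xm|_].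
        rewrite !mulr1; apply: le_trans (ler_norm C); apply: hC => j.
        by apply/ltW; move/cube0E : xm.
      by rewrite !mulr0.
    rewrite ge0_integral_mulr//.
    by rewrite integral_indic//= setIT lebesgueN_cube// -EFinM ltry.
  have s20 : 0 < 2 * s by rewrite mulr_gt0.
  have kB0 : 0 <= kappa * fine B by rewrite mulr_ge0// fine_ge0.
  have [r0 r00 hr0] := powRN_small kB0 eps0 s20.
  exists (Num.max 1 r0) => r rpos; rewrite ge_max => /andP[r1 r0r].
  have := split_estimate s0 p1 kappa0 lam0 r1 (mc m%:R) crit mU U0 (energy r rpos).
  move/le_trans; apply.
  rewrite (_ : 3 * eps = eps + eps + eps); last by ring.
  rewrite !EFinD; apply: leeD; first apply: leeD.
  - by rewrite -/B -(fineK Bfin) -EFinM lee_fin mulrAC hr0.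
  - apply: (@le_trans _ _ (lam%:E * (eps / lam)%:E)%E); last first.
      by rewrite -EFinM lee_fin mulrCA divff ?mulr1// gt_eqF.
    apply: lee_wpmul2l; first by rewrite lee_fin ltW.
    apply: le_trans hm; apply: ge0_le_integralr => //.
    + apply: measurable_funM; first by apply: measurable_indic; exact: measurableC.
      exact: measurable_funM.
    + by apply: measurable_funM => //; apply: measurable_indic; exact: measurableC.
    + by move=> x; rewrite !mulr_ge0.
    + move=> x; rewrite ler_wpM2l// ler_piMl//.
      apply: le_trans (weight_le_cube0 _ rpos) _.
      by rewrite indicE lern1 leq_b1.
  - rewrite lee_fin; apply: le_trans hlam.
    rewrite powRM ?invr_ge0 ?(ltW lam0)// -[lam^-1]powR_inv1 ?(ltW lam0)// -powRrM mulN1r.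
    by rewrite le_eqVlt; apply/orP; left; apply/eqP; ring.
apply/le_anti; rewrite S0 andbT; apply/lee_addgt0Pr => delta delta0; rewrite add0e.
have c0 : 0 < (4 / 3 : R) ^+ n by rewrite exprn_gt0// divr_gt0.
have [|r0 hr0] := small (delta / (3 * (4 / 3) ^+ n)).
  by rewrite divr_gt0// mulr_gt0.
apply: le_trans (integral_le_of_weights mUp Up0 hr0) _.
rewrite lee_fin le_eqVlt; apply/orP; left; apply/eqP.
by field; rewrite gt_eqF.
Qed.

End vanishing.

(** * The Liouville theorem *)

Lemma Cs_ge0 (R : realType) (s : R) : 0 <= Cs s.
Proof.
rewrite invr_ge0; apply: Rintegral_ge0 => x _.
by rewrite divr_ge0 ?powR_ge0// subr_ge0 cos_le1.
Qed.

Lemma eq0_of_integral_powR (R : realType) (N : nat) (p : R) (u : 'rV[R]_N -> R) :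
  continuous u -> (forall x, 0 <= u x) ->
  measurable_fun [set: N.-tuple (measurableTypeR R)] (u \o row_of_tuple) ->
  0 < p ->
  (\int[lebesgueN R N]_x ((u \o row_of_tuple) x `^ p)%:E = 0)%E ->
  forall x, u x = 0.
Proof.
move=> cu u0 mU p0 Iu x; apply: contrapT => /eqP ux.
have {ux} ux : 0 < u x by rewrite lt0r ux u0.
have v0 : 0 < u x / 2 by rewrite divr_gt0.
have : \forall y \near x, u x / 2 < u y.
  by apply: (cvgr_gt _ (cu x)); rewrite ltr_pdivrMr// ltr_pMr// ltr1n.
move=> /nbhs_ballP[delta /= delta0 hdelta].
pose c : N.-tuple (measurableTypeR R) := [tuple x ord0 i | i < N].
have mc := measurable_cube c delta.
have : (\int[lebesgueN R N]_y ((u x / 2) `^ p * \1_(cube c delta) y)%:E <= 0)%E.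
  rewrite -Iu; apply: ge0_le_integralr.
  - by apply: measurable_funM => //; exact: measurable_indic.
  - exact: (measurableT_comp (measurable_powR p) mU).
  - by move=> y; rewrite mulr_ge0// powR_ge0.
  move=> y; rewrite indicE; case: (boolP (y \in _)) => [/set_mem yc|_]; last first.
    by rewrite mulr0 powR_ge0.
  rewrite mulr1; apply: ge0_ler_powR; rewrite ?nnegrE ?(ltW p0) ?(ltW v0)//.
    exact: u0.
  apply/ltW/hdelta; split => // i j; rewrite !mxE.
  by have := yc j; rewrite /c tnth_mktuple (ord1 i).
rewrite ge0_integral_mulr ?powR_ge0//.
rewrite integral_indic//= setIT lebesgueN_cube ?(ltW delta0)//.
rewrite -EFinM lee_fin leNgt; apply/negP; rewrite negbK.
by rewrite mulr_gt0 ?powR_gt0// exprn_gt0// mulrn_wgt0.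
Qed.

Theorem theorem1p2 (R : realType) (N : nat) (s p : R) (u : 'rV[R]_N -> R)
  (N_ge2 : (2 <= N)%N)
  (s_gt0 : 0 < s) (s_lt1 : s < 1)
  (p_gt1 : 1 < p) (p_le : p <= N%:R / (N%:R - 2 * s))
  (u_C2 : Ck 2 u) (u_Ls : Ls s u)
  (u_ge0 : forall x, 0 <= u x)
  (u_sol : forall x, - Iop s u x >= u x `^ p) :
  forall x, u x = 0.
Proof.
have cu : continuous u by case: u_C2.
have mU : measurable_fun [set: N.-tuple (measurableTypeR R)] (u \o row_of_tuple).
  by case: u_Ls => -[].
have N2 : 2 <= N%:R :> R by rewrite (ler_nat R 2).
have crit : N%:R * (p - 1) <= 2 * s * p.
  by move: p_le; rewrite ler_pdivlMr; lra.
have c0 : 0 <= Cs s / 2 by rewrite divr_ge0// Cs_ge0.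
have bounded (i : 'I_N) (rho : R) : 0 <= rho -> exists C : R, forall x,
    (forall j, `|tnth x j| <= rho) ->
    (axis_integral (@posr R) s (u \o row_of_tuple) i x <= C%:E)%E /\
    (axis_integral (@negr R) s (u \o row_of_tuple) i x <= C%:E)%E.
  move=> rho0.
  have [C hC] := axis_integral_bounded i s_gt0 s_lt1 u_C2 u_Ls rho0.
  exists C => x xrho; split; apply: hC => //.
  - exact: measurable_posr.
  - by move=> z; rewrite posr_ge0 ge_max ler_norm normr_ge0.
  - exact: measurable_negr.
  - by move=> z; rewrite negr_ge0 ge_max normr_ge0 -normrN ler_norm.
have finite x (i : 'I_N) :
    (axis_integral (@posr R) s (u \o row_of_tuple) i x < +oo)%E /\
    (axis_integral (@negr R) s (u \o row_of_tuple) i x < +oo)%E.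
  have rho0 : 0 <= \sum_(j < N) `|tnth x j| by exact: sumr_ge0.
  have [C /(_ x)[]] := bounded i _ rho0.
    by move=> j; rewrite (bigD1 j)//= lerDl sumr_ge0.
  by move=> hP hQ; split; [apply: le_lt_trans hP _|apply: le_lt_trans hQ _]; exact: ltry.
have [|kappa kappa0 energy] := @energy_inequality R N (u \o row_of_tuple) s p
  (Cs s / 2) s_gt0 s_lt1 c0 mU (fun x => u_ge0 _)
  (fun i x => @continuous_tupd R N u i x cu) bounded.
  move=> x; apply: le_trans (u_sol _) _; rewrite /Iop -sumrN.
  by apply: ler_sum => i _; have [hP hQ] := finite x i; rewrite IiE.
apply: (eq0_of_integral_powR cu u_ge0 mU (lt_trans ltr01 p_gt1)).
apply: (integral_powR_eq0 s_gt0 p_gt1 kappa0 crit mU (fun x => u_ge0 _) _ energy).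
move=> rho _; have [C _ hC] := continuous_slab_bounded rho cu.
exists C => x xrho; apply: le_trans (ler_norm _) _; apply: hC => j.
by rewrite mxE.
Qed.
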